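(* Let $k\ge1$ and let $\mathbb{K}$ be a field. If there is a matrix $M\in\mathbb{R}^{n_1\times n_2}$ of tropical rank $\le k$ and of Kapranov rank (over $\mathbb{K}$) $>k$, then $\mathrm{Pf}_k(n)\ne\mathrm{trop}(\mathcal{P}f_k(n))$, where $n=n_1+n_2$. This happens (for $\mathbb{K}=\mathbb{Q}$, $\mathbb{R}$ or $\mathbb{C}$), for example, for $k=3$ and any $n\ge14$, and for any $k\ge4$ and any $n\ge2k+4$.
   Context: For a weight vector $v$ on the variables of a polynomial ring over $\mathbb{K}$, $\mathrm{in}_v(f)$ is the sum of the terms of $f$ of maximum $v$-weight and $\mathrm{in}_v(I)$ is the ideal generated by $\mathrm{in}_v(f)$, $f\in I$. The tropical variety of (the variety $V$ of) an ideal $I$, denoted $\mathrm{trop}(V)$, is the set of real weight vectors $v$ such that $\mathrm{in}_v(I)$ contains no monomial. Edges $\{i,j\},\{i',j'\}$ with $i<j$, $i'<j'$ cross if $i<i'<j<j'$ or $i'<i<j'<j$. For $U\subset[n]$ with $|U|=2k+2$, the Pfaffian of degree $k+1$ of $U$ is $\sum_E(-1)^{\mathrm{cr}(E)}\prod_{\{i,j\}\in E}x_{i,j}$ over perfect matchings $E$ of $U$, where $\mathrm{cr}(E)$ is the number of crossing pairs in $E$. $\mathcal{P}f_k(n)$ is the variety in $\mathbb{K}^{\binom{[n]}{2}}$ of the ideal $I_k(n)$ generated by all these Pfaffians. $\mathrm{Pf}_k(n)$ (the tropical Pfaffian prevariety) is the set of $v\in\mathbb{R}^{\binom{[n]}{2}}$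 such that, for every $U\in\binom{[n]}{2k+2}$, the maximum of $\sum_{\{i,j\}\in E}v_{i,j}$ over perfect matchings $E$ of $U$ is attained at least twice. A real square matrix $M=(m_{ij})$ of size $r$ is tropically singular if $\max_{\sigma\in S_r}\sum_i m_{i\sigma(i)}$ is attained by at least two permutations, and tropically regular otherwise. The tropical rank of a matrix is the largest size of a tropically regular square submatrix (minor). The Kapranov rank of $M\in\mathbb{R}^{n_1\times n_2}$ over $\mathbb{K}$ is the smallest $r$ such that $M$ lies in the tropical variety of the ideal of $\mathbb{K}[y_{ij}]$ generated by the $(r+1)\times(r+1)$ minors of a generic $n_1\times n_2$ matrix $(y_{ij})$; equivalently, it is the smallest rank of a lift of $M$ to a matrix over a valued field (extending $\mathbb{K}$) whose entries have degrees $m_{ij}$. *)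

(* Defs.v *)
From HB Require Import structures.
From mathcomp Require Import all_boot all_order all_fingroup all_algebra.
From mathcomp Require Import boolp classical_sets reals complex mpoly.

Set Implicit Arguments.
Unset Strict Implicit.
Unset Printing Implicit Defensive.

Import Order.TTheory GRing.Theory Num.Theory.
Local Open Scope ring_scope.

(* The polynomial ring with one variable for each element of a finite type T
   is {mpoly K[#|T|]}, the variable of t being 'X_(enum_rank t).            *)

Definition ideal_gen (A : comNzRingType) (S : set A) : set A :=
  [set p | exists s : seq (A * A),
     (forall x, x \in s -> S x.2) /\ p = \sum_(x <- s) x.1 * x.2].

Section Tropical.
Variables (R : realType) (K : fieldType) (T : finType).
Implicit Types (v : T -> R) (m : 'X_{1..#|T|}) (f : {mpoly K[#|T|]}).

Definition mweight v m : R := \sum_(t : T) v t *+ m (enum_rank t).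

Definition initial_form v f : {mpoly K[#|T|]} :=
  \sum_(m <- msupp f | all (fun m' => mweight v m' <= mweight v m) (msupp f))
     f@_m *: 'X_[m].

Definition initial_ideal v (I : set {mpoly K[#|T|]}) : set {mpoly K[#|T|]} :=
  ideal_gen [set initial_form v f | f in I].

Definition trop (I : set {mpoly K[#|T|]}) : set (T -> R) :=
  [set v | forall m, ~ initial_ideal v I 'X_[m]].

End Tropical.

Arguments trop R {K T} I.

Definition max_attained_twice (R : realType) (T : finType) (P : pred T)
    (F : T -> R) : bool :=
  [exists x, exists y, [&& P x, P y, x != y, F x == F y &
     [forall z, P z ==> (F z <= F x)]]].

Section Pfaffians.
Variable n : nat.

Definition edge := {e : 'I_n * 'I_n | (e.1 < e.2)%N}.

Definition cross (e f : edge) : bool :=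
  let: (i, j) := val e in let: (i', j') := val f in
  (i < i' < j)%N && (j < j')%N || (i' < i < j')%N && (j' < j)%N.

Definition incident (u : 'I_n) (e : edge) : bool :=
  (u == (val e).1) || (u == (val e).2).

Definition perfect_matching (U : {set 'I_n}) (E : {set edge}) : bool :=
  [forall e in E, [forall u, incident u e ==> (u \in U)]] &&
  [forall u in U, #|[set e in E | incident u e]| == 1%N].

Definition crossing_number (E : {set edge}) : nat :=
  #|[set [set e; f] | e in E, f in E & cross e f]|.

Definition pfaffian (K : fieldType) (U : {set 'I_n}) : {mpoly K[#|{: edge}|]} :=
  \sum_(E : {set edge} | perfect_matching U E)
     (-1) ^+ crossing_number E * \prod_(e in E) 'X_(enum_rank e).

Definition pfaffian_ideal (K : fieldType) (k : nat) : set {mpoly K[#|{: edge}|]} :=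
  ideal_gen [set pfaffian K U | U in [set U : {set 'I_n} | #|U| = (2 * k + 2)%N]].

Definition pfaffian_prevariety (R : realType) (k : nat) : set (edge -> R) :=
  [set v | forall U : {set 'I_n}, #|U| = (2 * k + 2)%N ->
     max_attained_twice (perfect_matching U) (fun E => \sum_(e in E) v e)].

End Pfaffians.

Arguments pfaffian_ideal n K k : clear implicits.
Arguments pfaffian_prevariety n R k : clear implicits.

Definition increasing (r n : nat) (f : {ffun 'I_r -> 'I_n}) : bool :=
  [forall i : 'I_r, forall j : 'I_r, (i < j)%N ==> (f i < f j)%N].

Definition tropically_singular (R : realType) (r : nat) (A : 'M[R]_r) : bool :=
  max_attained_twice predT (fun s : 'S_r => \sum_i A i (s i)).

Section Ranks.
Variables (R : realType) (n1 n2 : nat).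

Definition has_regular_minor (M : 'M[R]_(n1, n2)) (r : nat) : bool :=
  [exists f : {ffun 'I_r -> 'I_n1}, exists g : {ffun 'I_r -> 'I_n2},
     [&& increasing f, increasing g & ~~ tropically_singular (mxsub f g M)]].

Definition tropical_rank (M : 'M[R]_(n1, n2)) : nat :=
  \max_(r < (minn n1 n2).+1 | has_regular_minor M r) r.

Variable K : fieldType.

Definition generic_mx : 'M[{mpoly K[#|{: 'I_n1 * 'I_n2}|]}]_(n1, n2) :=
  \matrix_(i, j) 'X_(enum_rank (i, j)).

Definition minor_ideal (r : nat) : set {mpoly K[#|{: 'I_n1 * 'I_n2}|]} :=
  ideal_gen [set p | exists (f : {ffun 'I_r -> 'I_n1}) (g : {ffun 'I_r -> 'I_n2}),
     [/\ increasing f, increasing g & p = \det (mxsub f g generic_mx)]].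

Definition in_trop_minors (M : 'M[R]_(n1, n2)) (r : nat) : bool :=
  `[< trop R (minor_ideal r.+1) (fun ij => M ij.1 ij.2) >].

Lemma in_trop_minors_ex (M : 'M[R]_(n1, n2)) : exists r, in_trop_minors M r.
Proof.
exists n1; apply/asboolP => m [s [sI]] /(congr1 (mcoeff m)).
rewrite mcoeffX eqxx big_seq big1 ?mcoeff0; first by move/eqP; rewrite oner_eq0.
move=> x /sI [f [t [tm ->]]] <-; rewrite [X in initial_form _ X]big_seq big1.
  by rewrite /initial_form msupp0 big_nil mulr0.
move=> y /tm [g [h [/forallP g_inc _ _]]].
have g_inj : injective g.
  move=> i j gij; apply/val_inj/eqP; rewrite eqn_leq leqNgt.
  have /forallP /(_ i) /implyP ji := g_inc j.
  have /forallP /(_ j) /implyP ij := g_inc i.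
  apply/andP; split; first by apply/negP => /ji; rewrite gij ltnn.
  by rewrite leqNgt; apply/negP => /ij; rewrite gij ltnn.
by have := leq_card g g_inj; rewrite !card_ord ltnn.
Qed.

Definition kapranov_rank (M : 'M[R]_(n1, n2)) : nat :=
  ex_minn (in_trop_minors_ex M).

End Ranks.

Arguments tropical_rank {R n1 n2} M.
Arguments kapranov_rank {R n1 n2} K M.

(* Main.v *)
Require Import Defs.
From HB Require Import structures.
From mathcomp Require Import all_boot all_order all_fingroup all_algebra.
From mathcomp Require Import boolp classical_sets reals complex mpoly.
From mathcomp Require Import ring lra zify.

(* A matrix [M] of tropical rank at most [k] is turned into a weight vector on
   the edges of the complete graph on rows and columns of [M]: the edge joining
   row [i] to column [j] has weight [M i j], and the edges inside one part are
   heavily penalised.  Up to sign and up to multiples of the penalised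
   variables, a Pfaffian on [k + 1] rows and [k + 1] columns is a minor of size
   [k + 1].  So a combination of minors whose initial form is a monomial, which
   exists as the Kapranov rank exceeds [k], gives such a combination of
   Pfaffians, once the penalty is large enough.  The weight vector is in the
   prevariety if the inner weights are chosen well: two rows [i] and [i'] get
   [max (M i 0) (M i' 0) - c], as if they were joined through the first column,
   so that any perfect matching can be modified without loss: by exchanging two
   edges, or by singularity of the minors of size [k + 1].

   Examples are the cocircuit matrix of the Fano plane (Develin, Santos,
   Sturmfels) and a 6 x 6 matrix of Shitov.  For both, an explicit combination of
   minors has a monomial as initial form.  Larger sizes are obtained by repeating
   a row, larger [k] by repeating the first row and the first column and putting
   a large entry where the copies meet. *)

Set Implicit Arguments.
Unset Strict Implicit.
Unset Printing Implicit Defensive.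

Import Order.TTheory GRing.Theory Num.Theory.
Local Open Scope ring_scope.

(* [mpoly] exports another [mweight]. *)
Local Notation mweight := Defs.mweight.

(** * Weights and initial forms *)

Section Ideals.
Variables (A : comNzRingType) (S : set A).

Lemma ideal_gen0 : ideal_gen S 0.
Proof. by exists [::]; rewrite big_nil. Qed.

Lemma ideal_genD p q : ideal_gen S p -> ideal_gen S q -> ideal_gen S (p + q).
Proof.
move=> [s [sS ->]] [t [tS ->]]; exists (s ++ t); rewrite big_cat; split=> // x.
by rewrite mem_cat => /orP[/sS|/tS].
Qed.

Lemma ideal_genM a p : ideal_gen S p -> ideal_gen S (a * p).
Proof.
move=> [s [sS ->]]; exists [seq (a * x.1, x.2) | x <- s]; split.
  by move=> x /mapP[y ys ->] /=; apply: sS.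
by rewrite big_map mulr_sumr; apply: eq_bigr => x _; rewrite mulrA.
Qed.

Lemma ideal_gen_gen p : S p -> ideal_gen S p.
Proof.
move=> Sp; exists [:: (1, p)]; rewrite big_seq1 mul1r; split=> // x.
by rewrite inE => /eqP ->.
Qed.

Lemma ideal_gen_sum (I : Type) (r : seq I) (P : pred I) (F : I -> A) :
  (forall i, P i -> ideal_gen S (F i)) -> ideal_gen S (\sum_(i <- r | P i) F i).
Proof.
move=> FS; elim/big_rec: _ => [|i p Pi]; first exact: ideal_gen0.
by apply: ideal_genD; apply: FS.
Qed.

End Ideals.

Lemma ideal_gen_sub (A : comNzRingType) (S S' : set A) :
  (forall p, S p -> ideal_gen S' p) ->
  forall p, ideal_gen S p -> ideal_gen S' p.
Proof.
move=> SS' p [s [sS ->]]; rewrite big_seq; apply: ideal_gen_sum => x /sS Sx.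
by apply: ideal_genM; apply: SS'.
Qed.

Section Weights.
Variables (R : realType) (K : fieldType) (T : finType).
Implicit Types (v : T -> R) (m : 'X_{1..#|T|}) (f g h : {mpoly K[#|T|]}).
Implicit Types (d e : R).

(** Bounds on the weights of the monomials replace a degree function: 0 satisfies every bound, and
    sums, products and substitutions need no case distinctions. *)
Definition wle v d f := forall m, f@_m != 0 -> mweight v m <= d.
Definition wlt v d f := forall m, f@_m != 0 -> mweight v m < d.

Definition mvar (t : T) : {mpoly K[#|T|]} := 'X_(enum_rank t).

Lemma mweightD v m1 m2 : mweight v (m1 + m2)%MM = mweight v m1 + mweight v m2.
Proof.
by rewrite /mweight -big_split /=; apply: eq_bigr => t _; rewrite mnmDE mulrnDr.
Qed.

Lemma mweight0 v : mweight v 0%MM = 0.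
Proof. by rewrite /mweight big1 // => t _; rewrite mnm0E. Qed.

Lemma mweight1 v t : mweight v U_(enum_rank t)%MM = v t.
Proof.
rewrite /mweight (bigD1 t) //= mnm1E eqxx mulr1n big1 ?addr0 // => t' tt'.
by rewrite mnm1E (inj_eq enum_rank_inj) eq_sym (negbTE tt').
Qed.

Lemma mweight_lin (v0 v1 : T -> R) (c : R) m :
  mweight (fun t => v0 t + c * v1 t) m = mweight v0 m + c * mweight v1 m.
Proof.
rewrite /mweight mulr_sumr -big_split /=; apply: eq_bigr => t _.
by rewrite mulrnDl mulrnAr.
Qed.

Lemma wltW v d f : wlt v d f -> wle v d f.
Proof. by move=> fd m /fd/ltW. Qed.

Lemma wle_le v d e f : d <= e -> wle v d f -> wle v e f.
Proof. by move=> de fd m /fd/le_trans; apply. Qed.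

Lemma wlt0 v d : wlt v d 0.
Proof. by move=> m; rewrite mcoeff0 eqxx. Qed.

Lemma wltN v d f : wlt v d f -> wlt v d (- f).
Proof. by move=> fd m; rewrite mcoeffN oppr_eq0 => /fd. Qed.

Lemma wltD v d f g : wlt v d f -> wlt v d g -> wlt v d (f + g).
Proof.
move=> fd gd m; rewrite mcoeffD; have [->|/fd //] := eqVneq f@_m 0.
by rewrite add0r => /gd.
Qed.

Lemma wlt_sum v d (I : Type) (r : seq I) (P : pred I) (F : I -> {mpoly K[#|T|]}) :
  (forall i, P i -> wlt v d (F i)) -> wlt v d (\sum_(i <- r | P i) F i).
Proof.
move=> Fd; elim/big_rec: _ => [|i p Pi]; first exact: wlt0.
by apply: wltD; apply: Fd.
Qed.

Lemma wle0 v d : wle v d 0. Proof. exact/wltW/wlt0. Qed.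

Lemma wleD v d f g : wle v d f -> wle v d g -> wle v d (f + g).
Proof.
move=> fd gd m; rewrite mcoeffD; have [->|/fd //] := eqVneq f@_m 0.
by rewrite add0r => /gd.
Qed.

Lemma wleN v d f : wle v d f -> wle v d (- f).
Proof. by move=> fd m; rewrite mcoeffN oppr_eq0 => /fd. Qed.

Lemma wleX v m : wle v (mweight v m) 'X_[m].
Proof. by move=> m'; rewrite mcoeffX; case: (m =P m') => [->//|]; rewrite eqxx. Qed.

Lemma wltX v d m : mweight v m < d -> wlt v d 'X_[m].
Proof. by move=> md m'; rewrite mcoeffX; case: (m =P m') => [<-//|]; rewrite eqxx. Qed.

Lemma wle_var v t : wle v (v t) (mvar t).
Proof. by rewrite -{1}(mweight1 v t); apply: wleX. Qed.

Lemma mcoeffM_neq0 f g m : (f * g)@_m != 0 ->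
  exists m1 m2, [/\ m = (m1 + m2)%MM, f@_m1 != 0 & g@_m2 != 0].
Proof.
rewrite -mcoeff_msupp => /msuppM_le/allpairsP[[m1 m2] /= [m1f m2g ->]].
by exists m1, m2; rewrite -!mcoeff_msupp.
Qed.

Lemma wleM v d e f g : wle v d f -> wle v e g -> wle v (d + e) (f * g).
Proof.
move=> fd ge m /mcoeffM_neq0[m1 [m2 [-> /fd le1 /ge le2]]].
by rewrite mweightD lerD.
Qed.

Lemma wlt_mul v d e f g : wle v d f -> wlt v e g -> wlt v (d + e) (f * g).
Proof.
move=> fd ge m /mcoeffM_neq0[m1 [m2 [-> /fd le1 /ge le2]]].
by rewrite mweightD ler_ltD.
Qed.

Lemma wleC v (c : K) : wle v 0 c%:MP.
Proof.
move=> m; rewrite mcoeffC; case: (m =P 0%MM) => [->|_]; last by rewrite mulr0 eqxx.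
by rewrite mweight0.
Qed.

Lemma wle_sign v (s : nat) : wle v 0 ((-1) ^+ s).
Proof.
by rewrite -(rmorph1 (@mpolyC _ K)) -rmorphN -rmorphXn; apply: wleC.
Qed.

Lemma wle_prod v (I : Type) (r : seq I) (P : pred I) (a : I -> {mpoly K[#|T|]})
    (d : I -> R) :
  (forall i, P i -> wle v (d i) (a i)) ->
  wle v (\sum_(i <- r | P i) d i) (\prod_(i <- r | P i) a i).
Proof.
move=> ad; elim/big_rec2: _ => [|i e p Pi]; last by apply: wleM; apply: ad.
by have := @wleC v 1.
Qed.

Lemma wlt_prod v (I : Type) (r : seq I) (P : pred I)
    (a b : I -> {mpoly K[#|T|]}) (d : I -> R) :
  (forall i, P i -> wle v (d i) (a i)) ->
  (forall i, P i -> wlt v (d i) (a i - b i)) ->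
  wlt v (\sum_(i <- r | P i) d i)
    (\prod_(i <- r | P i) a i - \prod_(i <- r | P i) b i).
Proof.
move=> ad abd; elim: r => [|i r IHr]; first by rewrite !big_nil subrr; apply: wlt0.
rewrite !big_cons; case: ifP => // Pi.
set x := \prod_(_ <- _ | _) a _ in IHr *; set y := \prod_(_ <- _ | _) b _ in IHr *.
(* Telescoping changes one factor at a time; [b i] inherits the bound of [a i], from which it
   differs by something of smaller weight. *)
have -> : a i * x - b i * y = (a i - b i) * x - b i * - (x - y).
  rewrite mulrN opprK mulrBl mulrBr; apply/eqP.
  by rewrite -subr_eq0 [_ - _ + (_ - _)]addrA subrK subrr.
have xd : wle v (\sum_(i <- r | P i) d i) x by apply: wle_prod.
apply: wltD; first by rewrite addrC mulrC; apply: wlt_mul xd (abd _ Pi).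
apply: wltN; apply: wlt_mul; last exact: wltN.
have -> : b i = a i - (a i - b i) by rewrite subKr.
by apply: wleD; [apply: ad | apply/wleN/wltW/abd].
Qed.

(* A matrix whose entries are bounded by potentials [u i + w j] may be replaced
   by its leading part with respect to these potentials. *)
Lemma wlt_det v (r : nat) (A B : 'M[{mpoly K[#|T|]}]_r) (u w : 'I_r -> R) :
  (forall i j, wle v (u i + w j) (A i j)) ->
  (forall i j, wlt v (u i + w j) (A i j - B i j)) ->
  wlt v (\sum_i u i + \sum_j w j) (\det A - \det B).
Proof.
move=> Auw ABuw; rewrite /determinant -sumrB; apply: wlt_sum => s _.
rewrite -mulrBr -[_ + _]add0r; apply: wlt_mul; first exact: wle_sign.
(* Every permutation gets the same bound, as it only reorders the column potentials. *)
have -> : \sum_i u i + \sum_j w j = \sum_i (u i + w (s i)).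
  by rewrite big_split /= [X in _ + X](reindex_inj (@perm_inj _ s)).
by apply: wlt_prod.
Qed.

(** Each of the finitely many monomials of [h] has a positive gap below [d1]; a large multiple of
    this gap outweighs any excess in [v0]. *)
Lemma wlt_large (v0 v1 : T -> R) d1 h : wlt v1 d1 h -> forall d0,
  exists c0, forall c, c0 <= c ->
    wlt (fun t => v0 t + c * v1 t) (d0 + c * d1) h.
Proof.
(* The threshold for one monomial. Absolute values keep it nonnegative, so the sum over the support
   is above each threshold; the [+ 1] makes the inequality strict. *)
move=> hd d0; pose q m := `|mweight v0 m - d0| / `|d1 - mweight v1 m| + 1.
have q_ge0 m : 0 <= q m by rewrite addr_ge0 // divr_ge0.
exists (\sum_(m <- msupp h) q m) => c c0c m mh.
have pos1 : 0 < d1 - mweight v1 m by rewrite subr_gt0 hd.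
have {}c0c : `|mweight v0 m - d0| / (d1 - mweight v1 m) + 1 <= c.
  apply: le_trans c0c; rewrite (bigD1_seq m) ?msupp_uniq ?mcoeff_msupp //=.
  by rewrite /q (gtr0_norm pos1) lerDl; apply: sumr_ge0 => m1 _; exact: q_ge0.
have : `|mweight v0 m - d0| < c * (d1 - mweight v1 m).
  by rewrite -ltr_pdivrMr // (lt_le_trans _ c0c) // ltrDl.
move/(le_lt_trans (ler_norm _)).
by rewrite mweight_lin ltrBlDr mulrBr addrAC ltrBrDr [_ + d0]addrC.
Qed.

Lemma initial_form_dominated v f m (c : K) : c != 0 ->
  wlt v (mweight v m) (f - c *: 'X_[m]) -> initial_form v f = c *: 'X_[m].
Proof.
move=> c0 fm.
(* A nonzero coefficient of the difference at [m] would make [m] lighter than itself. *)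
have fm_c : f@_m = c.
  apply/eqP; rewrite -subr_eq0; apply/negPn/negP => neq.
  have := fm m; rewrite mcoeffB mcoeffZ mcoeffX eqxx mulr1 neq.
  by rewrite ltxx => /(_ isT).
have lt_m m' : m' \in msupp f -> m' != m -> mweight v m' < mweight v m.
  rewrite mcoeff_msupp => m'f m'm; apply: fm.
  by rewrite mcoeffB mcoeffZ mcoeffX [m == _]eq_sym (negbTE m'm) mulr0 subr0.
have mf : m \in msupp f by rewrite mcoeff_msupp fm_c.
rewrite /initial_form big_mkcond (bigD1_seq m) ?msupp_uniq //= fm_c.
rewrite ifT; last first.
  apply/allP => m' m'f; have [->//|m'm] := eqVneq m' m.
  exact/ltW/lt_m.
rewrite big_seq_cond big1 ?addr0 // => m' /andP[m'f m'm]; case: ifP => // /allP.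
by move=> /(_ m mf); rewrite leNgt lt_m.
Qed.

Lemma notin_trop v (S : set {mpoly K[#|T|]}) f m (c : K) : c != 0 ->
  ideal_gen S f -> wlt v (mweight v m) (f - c *: 'X_[m]) ->
  ~ trop R (ideal_gen S) v.
Proof.
move=> c0 Sf fm /(_ m); apply.
have -> : 'X_[m] = (c^-1)%:MP * initial_form v f.
  by rewrite (initial_form_dominated c0 fm) mul_mpolyC scalerA mulVf ?scale1r.
by apply: ideal_genM; apply: ideal_gen_gen; exists f.
Qed.

Definition wpart v d f : {mpoly K[#|T|]} :=
  \sum_(m <- msupp f | mweight v m == d) f@_m *: 'X_[m].

Lemma mcoeff_wpart v d f m :
  (wpart v d f)@_m = if mweight v m == d then f@_m else 0.
Proof.
rewrite /wpart raddf_sum /=.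
under eq_bigr => m' _ do rewrite mcoeffZ mcoeffX.
have [mf|mf] := boolP (m \in msupp f); last first.
  rewrite big_seq_cond big1 => [|m' /andP[m'f _]].
    by move: mf; rewrite -mcoeff_eq0 => /eqP ->; rewrite if_same.
  by case: (m' =P m) => [e|]; rewrite ?mulr0 //; rewrite -e m'f in mf.
rewrite big_mkcond (bigD1_seq m) ?msupp_uniq //= eqxx mulr1 big1 ?addr0 //.
by move=> m' /negbTE ->; rewrite mulr0 if_same.
Qed.

Lemma mcoeff_initial v f m : (initial_form v f)@_m =
  if all (fun m' => mweight v m' <= mweight v m) (msupp f) then f@_m else 0.
Proof.
rewrite /initial_form raddf_sum /=.
under eq_bigr => m' _ do rewrite mcoeffZ mcoeffX.
have [mf|mf] := boolP (m \in msupp f); last first.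
  rewrite big_seq_cond big1 => [|m' /andP[m'f _]].
    by move: mf; rewrite -mcoeff_eq0 => /eqP ->; rewrite if_same.
  by case: (m' =P m) => [e|]; rewrite ?mulr0 //; rewrite -e m'f in mf.
rewrite big_mkcond (bigD1_seq m) ?msupp_uniq //= eqxx mulr1 big1 ?addr0 //.
by move=> m' /negbTE ->; rewrite mulr0 if_same.
Qed.


Lemma seq_argmax (I : eqType) (s : seq I) (F : I -> R) : s != [::] ->
  exists2 x, x \in s & forall y, y \in s -> F y <= F x.
Proof.
elim: s => // x s IHs _; have [->|/IHs[y ys ymax]] := eqVneq s [::].
  by exists x; rewrite ?inE // => y; rewrite inE => /eqP ->.
have [le_xy|lt_yx] := leP (F x) (F y).
  exists y; first by rewrite inE ys orbT.
  by move=> z; rewrite inE => /orP[/eqP ->|/ymax].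
exists x; first by rewrite inE eqxx.
move=> z; rewrite inE => /orP[/eqP ->//|/ymax /le_trans]; apply.
exact: ltW.
Qed.

Lemma initial_wlt v f : f != 0 -> exists d,
  [/\ wlt v d (f - initial_form v f)
    & forall m, (initial_form v f)@_m != 0 -> mweight v m = d].
Proof.
rewrite -msupp_eq0 => /(seq_argmax (mweight v)) [m0 m0f m0max].
exists (mweight v m0); split=> m.
  rewrite mcoeffB mcoeff_initial; case: allP => [_|nmax]; first by rewrite subrr eqxx.
  rewrite subr0 -mcoeff_msupp => mf; rewrite lt_neqAle m0max // andbT.
  by apply/eqP => e; apply: nmax => m' /m0max; rewrite e.
rewrite mcoeff_initial; case: allP => [mmax|]; last by rewrite eqxx.
by rewrite -mcoeff_msupp => /m0max le1; apply/le_anti; rewrite le1 mmax.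
Qed.

(* Ideal elements need not be homogeneous; cutting the cofactors down to one
   weight turns a combination of initial forms into an initial form. *)
Lemma ideal_initial_part v (S : set {mpoly K[#|T|]}) D a f : ideal_gen S f ->
  exists2 g, ideal_gen S g & forall m, D <= mweight v m ->
    g@_m = if mweight v m == D then (a * initial_form v f)@_m else 0.
Proof.
move=> Sf; have [->|/(initial_wlt v) [d [fd ind]]] := eqVneq f 0.
  exists 0; first exact: ideal_gen0.
  by move=> m _; rewrite /initial_form msupp0 big_nil mulr0 mcoeff0 if_same.
set b := wpart v (D - d) a; set h := initial_form v f in fd ind *.
exists (b * f); first exact: ideal_genM.
have bw m : b@_m != 0 -> mweight v m = D - d.
  by rewrite mcoeff_wpart; case: (mweight v m =P _) => // _; rewrite eqxx.
have bh m : (b * h)@_m != 0 -> mweight v m = D.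
  by move=> /mcoeffM_neq0[m1 [m2 [-> /bw e1 /ind e2]]]; rewrite mweightD e1 e2 subrK.
have abh m : mweight v m = D -> ((a - b) * h)@_m = 0.
  move=> mD; apply/eqP/negPn/negP => /mcoeffM_neq0[m1 [m2 [e]]].
  rewrite mcoeffB mcoeff_wpart => am1 /ind m2d; move: am1.
  by rewrite -mD e mweightD m2d addrK eqxx subrr eqxx.
move=> m Dm; have -> : (b * f)@_m = (b * h)@_m.
  apply/eqP; rewrite -subr_eq0 -mcoeffB -mulrBr; apply/negPn/negP => neq.
  have /(_ m neq) : wlt v D (b * (f - h)).
    have -> : D = (D - d) + d by rewrite subrK.
    by apply: wlt_mul => // m' /bw ->.
  by rewrite ltNge Dm.
case: (mweight v m =P D) => [mD|mD].
  by apply/eqP; rewrite eq_sym -subr_eq0 -mcoeffB -mulrBl abh.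
by apply/eqP/negPn/negP => /bh.
Qed.

(** This trades a monomial in the ideal generated by the initial forms for a single element of the
    ideal whose initial form is a monomial. In a combination of initial forms, [ideal_initial_part]
    replaces each summand by an ideal element that agrees with it in the weight of the monomial and
    has nothing above. *)
Lemma notin_tropP v (S : set {mpoly K[#|T|]}) :
  ~ trop R (ideal_gen S) v <->
  exists f m, ideal_gen S f /\ wlt v (mweight v m) (f - 'X_[m]).
Proof.
split=> [|[f [m [Sf fm]]]]; last first.
  by apply: (@notin_trop v S f m 1 _ Sf); rewrite ?oner_eq0 ?scale1r.
move=> ntrop; apply: contrapT => nex; apply: ntrop => m [s [sI Xm]].
apply: nex; have [g Sg gs] : exists2 g, ideal_gen S g &
    forall m', mweight v m <= mweight v m' ->
    g@_m' = if mweight v m' == mweight v m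
            then (\sum_(x <- s) x.1 * x.2)@_m' else 0.
  elim: s sI {Xm} => [|x s IHs] sI.
    exists 0; first exact: ideal_gen0.
    by move=> m' _; rewrite big_nil mcoeff0 if_same.
  have [g Sg gE] := IHs (fun y ys => sI y (mem_behead (s := x :: s) ys)).
  have [f Sf xE] := sI x (mem_head _ _).
  have [h Sh hE] := ideal_initial_part v (mweight v m) x.1 Sf.
  exists (h + g) => [|m' lem]; first exact: ideal_genD.
  rewrite mcoeffD hE // gE // big_cons xE mcoeffD.
  by case: (mweight v m' =P _); rewrite ?addr0.
exists g, m; split=> // m'; rewrite mcoeffB => neq.
rewrite ltNge; apply/negP => lem; move: neq; rewrite gs // -Xm mcoeffX.
case: (mweight v m' =P _) => wE; first by rewrite subrr eqxx.
by case: (m =P m') => [e|_]; rewrite ?subr0 ?eqxx //; rewrite e in wE.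
Qed.

End Weights.

Arguments mvar {K T} t.

(** * Renaming of variables *)

Section Substitution.
Variables (R : realType) (K : fieldType) (T T' : finType) (h : T -> T').

(** Renaming along [h] is set up as a ring morphism so that it commutes with determinants. *)
Definition msubst (f : {mpoly K[#|T|]}) : {mpoly K[#|T'|]} :=
  mmap (@mpolyC _ _) (fun i => mvar (h (enum_val i))) f.

Lemma msubst_is_additive : additive msubst.
Proof. exact: raddfB. Qed.

HB.instance Definition _ := GRing.isAdditive.Build _ _ msubst msubst_is_additive.

Lemma msubst_is_multiplicative : multiplicative msubst.
Proof. by split=> [p q|]; rewrite /msubst ?rmorphM ?rmorph1. Qed.

HB.instance Definition _ :=
  GRing.isMultiplicative.Build _ _ msubst msubst_is_multiplicative.

Lemma msubst_var t : msubst (mvar t) = mvar (h t).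
Proof. by rewrite /msubst mmapX mmap1U enum_rankK. Qed.

(** Exponents add up along the fibres of [h]. One monomial [m'] has to serve all weights [v'], as it
    is later weighed by both [v0] and [v1]. *)
Lemma msubstX (m : 'X_{1..#|T|}) : exists2 m', msubst 'X_[m] = 'X_[m'] &
  forall (v' : T' -> R), mweight v' m' = mweight (v' \o h) m.
Proof.
pose g (i : 'I_#|T|) := U_(enum_rank (h (enum_val i)))%MM : 'X_{1..#|T'|}.
exists (\big[+%MM/0%MM]_i (g i *+ m i)%MM).
  by rewrite /msubst mmapX -mprodXnE.
move=> v'; have wn m' k : mweight v' (m' *+ k)%MM = mweight v' m' *+ k.
  by elim: k => [|k IHk]; rewrite ?mulm0n ?mweight0 // mulmS mweightD IHk mulrS.
rewrite (big_morph (mweight v') (@mweightD _ _ v') (mweight0 v')) [RHS]/Defs.mweight.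
rewrite (reindex (@enum_rank T)) /=; last exact/onW_bij/enum_rank_bij.
by apply: eq_bigr => t _; rewrite wn mweight1 enum_rankK.
Qed.

Lemma wlt_msubst (v' : T' -> R) d f : wlt (v' \o h) d f -> wlt v' d (msubst f).
Proof.
move=> fd; rewrite /msubst /mmap big_seq; apply: wlt_sum => m.
rewrite mcoeff_msupp => /fd mf; rewrite -[d]add0r.
apply: wlt_mul; first exact: wleC.
have [m' + wm'] := msubstX m; rewrite /msubst mmapX => ->.
by apply: wltX; rewrite wm'.
Qed.

Lemma wle_msubst (v' : T' -> R) d f : wle (v' \o h) d f -> wle v' d (msubst f).
Proof.
move=> fd; rewrite /msubst /mmap big_seq; elim/big_rec: _ => [|m p].
  exact: wle0.
rewrite mcoeff_msupp => /fd mf; apply: wleD.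
have [m' + wm'] := msubstX m; rewrite /msubst mmapX => -> m1.
rewrite mul_mpolyC mcoeffZ mcoeffX; case: (m' =P m1) => [<-|]; first by rewrite wm'.
by rewrite mulr0 eqxx.
Qed.

End Substitution.

(** * Tropically singular minors *)

Lemma eq_ler (R : realType) (x y : R) : x = y -> x <= y.
Proof. by move=> ->. Qed.

(** A form that names no maximiser: from any candidate one can pass to a different one that is at
    least as good. Applied to a maximiser, this yields the second one. *)
Lemma max_attained_twiceP (R : realType) (T : finType) (P : pred T) (F : T -> R) :
  max_attained_twice P F <->
  (exists x, P x) /\
  (forall x, P x -> exists2 y, P y && (y != x) & F x <= F y).
Proof.
split.
  move=> /existsP[x /existsP[y /and5P[Px Py xy /eqP Fxy /forallP Fmax]]].
  split=> [|z Pz]; first by exists x.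
  have := Fmax z; rewrite Pz /= => Fzx.
  have [zx|zx] := eqVneq z x; [exists y | exists x] => //.
  - by rewrite Py zx eq_sym.
  - by rewrite -Fxy.
  - by rewrite Px eq_sym.
move=> [[x0 Px0] ex]; case: (@arg_maxP _ _ _ x0 P F Px0) => x Px Fmax.
have [y /andP[Py yx] Fxy] := ex x Px.
apply/existsP; exists x; apply/existsP; exists y; rewrite Px Py eq_sym yx /=.
have le_yx : F y <= F x by exact: Fmax.
rewrite eq_le Fxy le_yx /=; apply/forallP => z; apply/implyP; exact: Fmax.
Qed.

Lemma increasing_inj r n (f : {ffun 'I_r -> 'I_n}) : increasing f -> injective f.
Proof.
move=> /forallP finc i j fij; apply/val_inj/eqP; rewrite eqn_leq leqNgt.
have /forallP /(_ i) /implyP ji := finc j.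
have /forallP /(_ j) /implyP ij := finc i.
apply/andP; split; first by apply/negP => /ji; rewrite fij ltnn.
by rewrite leqNgt; apply/negP => /ij; rewrite fij ltnn.
Qed.

Lemma increasing_leq r n (f : {ffun 'I_r -> 'I_n}) : increasing f -> (r <= n)%N.
Proof. by move=> /increasing_inj/leq_card; rewrite !card_ord. Qed.

Lemma increasing_lt r n (f : {ffun 'I_r -> 'I_n}) : increasing f ->
  forall i j : 'I_r, (i < j)%N -> (f i < f j)%N.
Proof. by move=> /forallP finc i j; have /forallP/(_ j)/implyP := finc i. Qed.

Lemma increasing_enum r n (S : {set 'I_n}) : #|S| = r ->
  exists2 f : {ffun 'I_r -> 'I_n}, increasing f &
    forall x, x \in S <-> exists i, x = f i.
Proof.
move=> <-; exists [ffun i => enum_val i].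
  apply/forallP => i; apply/forallP => j; apply/implyP => ij; rewrite !ffunE.
  have ltS : sorted (fun a b : 'I_n => (a < b)%N) (enum S).
    rewrite /enum_mem; apply: sorted_filter; first by move=> ? ? ?; apply: ltn_trans.
    have : sorted ltn (map val (enum 'I_n)) by rewrite val_enum_ord iota_ltn_sorted.
    by rewrite sorted_map enumT.
  rewrite (enum_val_nth (enum_val i)) [enum_val j](enum_val_nth (enum_val i)).
  apply: (sorted_ltn_nth _ _ ltS) => //; first by move=> ? ? ?; apply: ltn_trans.
  - by rewrite inE -cardE.
  - by rewrite inE -cardE.
move=> x; split=> [Sx|[i ->]]; last by rewrite ffunE enum_valP.
by exists (enum_rank_in Sx x); rewrite ffunE enum_rankK_in.
Qed.

(** Deleting row [i] and column [s i] from a permutation matrix leaves a permutation matrix: Laplace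
    expansion for a single permutation. *)
Lemma lift_perm_decomp r (s : 'S_r.+1) i :
  exists t : 'S_r, s = lift_perm i (s i) t.
Proof.
have ne j : s i != s (lift i j) by rewrite (inj_eq perm_inj) neq_lift.
pose f j := odflt j (unlift (s i) (s (lift i j))).
have fE j : lift (s i) (f j) = s (lift i j).
  by rewrite /f; case: unliftP (ne j) => [k ->//|->]; rewrite eqxx.
have finj : injective f.
  by move=> j k /(congr1 (lift (s i))); rewrite !fE => /perm_inj/lift_inj.
exists (perm finj); apply/permP => j; have [->|] := eqVneq j i.
  by rewrite lift_perm_id.
by rewrite eq_sym; case/unlift_some => k -> _; rewrite lift_perm_lift permE fE.
Qed.

Section Singular.
Variable R : realType.

Lemma tropically_singularP r (A : 'M[R]_r) :
  tropically_singular A <->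
  (forall s : 'S_r, exists2 t : 'S_r, t != s &
     \sum_i A i (s i) <= \sum_i A i (t i)).
Proof.
split=> [/max_attained_twiceP[_ ex] s|ex].
  by have [|t] := ex s; first by []; exists t.
apply/max_attained_twiceP; split; first by exists 1%g.
by move=> s _; have [t] := ex s; exists t.
Qed.

Definition singular_minors n1 n2 (M : 'M[R]_(n1, n2)) r :=
  forall (f : {ffun 'I_r -> 'I_n1}) (g : {ffun 'I_r -> 'I_n2}),
  increasing f -> increasing g -> tropically_singular (mxsub f g M).

Lemma sum_lift_perm r (A : 'I_r.+1 -> 'I_r.+1 -> R) i j (s : 'S_r) :
  \sum_k A k (lift_perm i j s k) = A i j + \sum_k A (lift i k) (lift j (s k)).
Proof.
rewrite (bigD1_ord i) //= lift_perm_id; congr (_ + _).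
by apply: eq_bigr => k _; rewrite lift_perm_lift.
Qed.

Lemma lift_ltn r (h : 'I_r.+1) (i j : 'I_r) :
  (i < j)%N -> (lift h i < lift h j)%N.
Proof. by move=> ij; rewrite /= ltnNge leq_bump2 -ltnNge. Qed.

(** Keep the entry that the permutation uses in the first row and improve on the complementary
    minor. Thus the tropical rank is at most [k] as soon as all minors of size [k + 1] are
    singular. *)
Lemma singular_minorsS n1 n2 (M : 'M[R]_(n1, n2)) r :
  singular_minors M r -> singular_minors M r.+1.
Proof.
move=> singM f g finc ginc; apply/tropically_singularP => s.
pose f' := [ffun i => f (lift ord0 i)]; pose g' := [ffun j => g (lift (s ord0) j)].
have f'inc : increasing f'.
  apply/forallP => i; apply/forallP => j; apply/implyP => ij; rewrite !ffunE.
  exact/(increasing_lt finc)/lift_ltn.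
have g'inc : increasing g'.
  apply/forallP => i; apply/forallP => j; apply/implyP => ij; rewrite !ffunE.
  exact/(increasing_lt ginc)/lift_ltn.
have [t sE] := lift_perm_decomp s ord0.
have /tropically_singularP/(_ t)[t' t't le_tt'] := singM _ _ f'inc g'inc.
exists (lift_perm ord0 (s ord0) t').
  apply: contraNneq t't => st'.
  apply/eqP/permP => i; apply: (@lift_inj _ (s ord0)).
  by rewrite -!(lift_perm_lift ord0) st' -sE.
rewrite {1}sE !sum_lift_perm lerD2l; apply: le_trans (le_trans _ le_tt') _.
  by apply/eq_ler/eq_bigr => i _; rewrite !mxE !ffunE.
by apply/eq_ler/eq_bigr => i _; rewrite !mxE !ffunE.
Qed.

Lemma tropical_rank_leP n1 n2 (M : 'M[R]_(n1, n2)) k :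
  (tropical_rank M <= k)%N <-> singular_minors M k.+1.
Proof.
split=> [/bigmax_leqP rkM f g finc ginc|singM].
  apply: contraT => reg.
  have ltk : (k.+1 < (minn n1 n2).+1)%N.
    by rewrite ltnS leq_min (increasing_leq finc) (increasing_leq ginc).
  suff /(rkM (Ordinal ltk)) : has_regular_minor M k.+1 by rewrite /= ltnn.
  by apply/existsP; exists f; apply/existsP; exists g; rewrite finc ginc.
apply/bigmax_leqP => -[r /= _] /existsP[f /existsP[g /and3P[finc ginc]]].
apply: contraR; rewrite -ltnNge => lt_kr.
suff : singular_minors M r by apply.
by rewrite -(subnKC lt_kr); elim: (_ - _)%N => [|d IHd]; rewrite ?addn0 // addnS; apply: singular_minorsS.
Qed.

(** Composing with the transposition of two equal rows changes the permutation but not its sum. *)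
Lemma singular_eq_rows n1 n2 r (M : 'M[R]_(n1, n2)) (f : 'I_r -> 'I_n1) g i j :
  i != j -> f i = f j -> tropically_singular (mxsub f g M).
Proof.
move=> ij fij; apply/tropically_singularP => s; exists (tperm i j * s)%g.
  apply: contraNneq ij => /(congr1 (fun t : 'S_r => t i)); rewrite permM tpermL.
  by move=> /perm_inj ->.
rewrite [leRHS](reindex_inj (@perm_inj _ (tperm i j))) /=; apply/eq_ler/eq_bigr => k _.
by rewrite !mxE permM tpermK; case: tpermP => [->|->|]; rewrite ?fij.
Qed.

Lemma singular_eq_cols n1 n2 r (M : 'M[R]_(n1, n2)) f (g : 'I_r -> 'I_n2) i j :
  i != j -> g i = g j -> tropically_singular (mxsub f g M).
Proof.
move=> ij gij; apply/tropically_singularP => s; exists (s * tperm i j)%g.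
  apply: contraNneq ij => /(congr1 (fun t : 'S_r => t (s^-1%g i))).
  by rewrite permM permKV tpermL => ->.
apply/eq_ler/eq_bigr => k _; rewrite !mxE permM.
by case: tpermP => [->|->|]; rewrite ?gij.
Qed.

Lemma inj_increasing r n (f : 'I_r -> 'I_n) : injective f ->
  exists f0 : {ffun 'I_r -> 'I_n}, exists2 p : 'S_r, increasing f0 &
    forall i, f i = f0 (p i).
Proof.
move=> finj; have [|f0 f0inc f0P] := @increasing_enum r n (f @: 'I_r).
  by rewrite card_imset ?card_ord.
have pP i : {j | f i = f0 j} by apply/cid/f0P/imset_f.
pose p i := sval (pP i); have pE i : f i = f0 (p i) := svalP (pP i).
have pinj : injective p by move=> i j pij; apply: finj; rewrite !pE pij.
by exists f0, (perm pinj) => // i; rewrite permE.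
Qed.

(** A repeated index gives equal rows or columns; distinct indices are sorted by permutations [p]
    and [q], which turn [s] into [p^-1 * s * q]. Such selections arise from matrices with repeated
    rows or columns. *)
Lemma singular_mxsub n1 n2 r (M : 'M[R]_(n1, n2)) (f : 'I_r -> 'I_n1) g :
  singular_minors M r -> tropically_singular (mxsub f g M).
Proof.
move=> singM; have [/injectiveP finj|] := boolP (injectiveb f); last first.
  by move=> /injectivePn[i [j ij fij]]; apply: singular_eq_rows ij fij.
have [/injectiveP ginj|] := boolP (injectiveb g); last first.
  by move=> /injectivePn[i [j ij gij]]; apply: singular_eq_cols ij gij.
have [f0 [p f0inc fE]] := inj_increasing finj.
have [g0 [q g0inc gE]] := inj_increasing ginj.
apply/tropically_singularP => s.
have /tropically_singularP/(_ (p^-1 * s * q)%g)[t tne le_t] := singM _ _ f0inc g0inc.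
exists (p * t * q^-1)%g.
  by apply: contraNneq tne => <-; rewrite !mulgA mulVg mul1g mulgKV.
rewrite (reindex_inj (@perm_inj _ (p^-1)%g)) /= [leRHS](reindex_inj (@perm_inj _ (p^-1)%g)) /=.
apply: le_trans (le_trans _ le_t) _; apply/eq_ler/eq_bigr => i _.
  by rewrite !mxE fE gE permKV !permM.
by rewrite !mxE fE gE !permM !permKV.
Qed.

End Singular.

(** * Degenerations and the Kapranov rank *)

Section Degeneration.
Variables (R : realType) (K : fieldType) (T T' : finType) (h : T -> T').
Variables (S : set {mpoly K[#|T|]}) (S' : set {mpoly K[#|T'|]}).
Variables (v : T -> R) (v0 v1 : T' -> R) (eps : K) (mz : 'X_{1..#|T'|}).
Hypothesis eps0 : eps != 0.
Hypothesis v0h : forall t, v0 (h t) = v t.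
Hypothesis v1h : forall t, v1 (h t) = 0.
Hypothesis gens : forall p, S p -> exists2 p', S' p' &
  wlt v1 (mweight v1 mz) (p' - eps *: 'X_[mz] * msubst h p).

Lemma wle_msubst0 (f : {mpoly K[#|T|]}) : wle v1 0 (msubst h f).
Proof.
apply: wle_msubst => m _; rewrite /Defs.mweight big1 // => t _ /=.
by rewrite v1h mul0rn.
Qed.

(** By [gens], a generator of the first ideal, renamed and multiplied by [eps] and the monomial of
    [mz], agrees up to lower [v1]-weight with a generator of the second one. This extends to
    combinations because renamed cofactors have [v1]-weight at most 0. *)
Lemma ideal_gen_degenerate f : ideal_gen S f -> exists2 F, ideal_gen S' F &
  wlt v1 (mweight v1 mz) (F - eps *: 'X_[mz] * msubst h f).
Proof.
move=> [s [sS ->]] {f}; elim: s sS => [|x s IHs] sS.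
  exists 0; first exact: ideal_gen0.
  by rewrite big_nil rmorph0 mulr0 subrr; apply: wlt0.
have [F SF Flt] := IHs (fun y ys => sS y (mem_behead (s := x :: s) ys)).
have [p' Sp' p'lt] := gens (sS x (mem_head _ _)).
exists (msubst h x.1 * p' + F).
  by apply: ideal_genD => //; apply/ideal_genM/ideal_gen_gen.
rewrite big_cons rmorphD rmorphM mulrDr opprD addrACA; apply: wltD => //.
rewrite mulrCA -mulrBr -[mweight v1 mz]add0r; apply: wlt_mul p'lt.
exact: wle_msubst0.
Qed.

(* With [c] large, [v0 + c v1] selects the part of top [v1]-weight first. *)
Lemma notin_trop_degenerate : ~ trop R (ideal_gen S) v ->
  exists c0, forall c, c0 <= c ->
    ~ trop R (ideal_gen S') (fun t => v0 t + c * v1 t).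
Proof.
move=> /notin_tropP[f [m [Sf fm]]]; have [F SF Fz] := ideal_gen_degenerate Sf.
have [m' mE wm'] := msubstX R K h m.
have [c0 Hc] := wlt_large v0 Fz (mweight v0 (mz + m')%MM).
exists c0 => c /Hc Fc; apply: (@notin_trop _ _ _ _ _ F (mz + m')%MM eps) => //.
have v1m' : mweight v1 m' = 0.
  by rewrite wm' /Defs.mweight big1 // => t _ /=; rewrite v1h mul0rn.
rewrite mweight_lin mpolyXD.
(* The first summand is light for large [c] by [wlt_large]. The second is a multiple of the renamed
   tail of [f], and along [h] the weight [v0 + c v1] is just [v]. *)
have -> : F - eps *: ('X_[mz] * 'X_[m']) =
  (F - eps *: 'X_[mz] * msubst h f) + eps *: 'X_[mz] * msubst h (f - 'X_[m]).
  have -> : msubst h (f - 'X_[m]) = msubst h f - 'X_[m'] by rewrite -mE /msubst mmapB.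
  rewrite mulrBr addrA subrK; congr (_ - _).
  by rewrite -scalerAl.
rewrite (mweightD v1) v1m' addr0; apply: wltD => //.
set vc := fun t => _; have -> : mweight v0 (mz + m')%MM + c * mweight v1 mz =
  mweight vc mz + mweight v m.
  rewrite mweightD mweight_lin wm' addrAC; congr (_ + _ + _).
  by apply: eq_bigr => t _ /=; rewrite v0h.
apply: wlt_mul.
  rewrite -mul_mpolyC -[mweight vc mz]add0r.
  by apply: wleM; [exact: wleC | exact: wleX].
apply: wlt_msubst; have -> // : vc \o h = v.
by apply/funext => t /=; rewrite /vc v0h v1h mulr0 addr0.
Qed.

End Degeneration.

Lemma trop_sub (R : realType) (K : fieldType) (T : finType) (v : T -> R)
    (I J : set {mpoly K[#|T|]}) :
  (forall p, I p -> J p) -> trop R J v -> trop R I v.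
Proof.
move=> IJ vJ m vI; apply: (vJ m); apply: ideal_gen_sub vI => p [q Iq <-].
by apply: ideal_gen_gen; exists q => //; apply: IJ.
Qed.

Section Kapranov.
Variables (R : realType) (K : fieldType).

Definition minor_gens n1 n2 r : set {mpoly K[#|{: 'I_n1 * 'I_n2}|]} :=
  [set p | exists (f : {ffun 'I_r -> 'I_n1}) (g : {ffun 'I_r -> 'I_n2}),
     [/\ increasing f, increasing g & p = \det (mxsub f g (generic_mx n1 n2 K))]].

(** Laplace expansion along the first row. Membership in the tropical varieties is therefore
    monotone in the size of the minors, and a Kapranov rank above [k] amounts to failure at size
    [k + 1] alone. *)
Lemma minor_idealS n1 n2 r p :
  @minor_ideal n1 n2 K r.+1 p -> @minor_ideal n1 n2 K r p.
Proof.
apply: ideal_gen_sub => _ [f [g [finc ginc ->]]].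
rewrite (expand_det_row _ ord0); apply: ideal_gen_sum => j _.
rewrite /cofactor mulrA; apply/ideal_genM/ideal_gen_gen.
exists [ffun i => f (lift ord0 i)], [ffun i => g (lift j i)]; split.
- apply/forallP => a; apply/forallP => b; apply/implyP => ab; rewrite !ffunE.
  exact/(increasing_lt finc)/lift_ltn.
- apply/forallP => a; apply/forallP => b; apply/implyP => ab; rewrite !ffunE.
  exact/(increasing_lt ginc)/lift_ltn.
by congr (\det _); apply/matrixP => a b; rewrite !mxE !ffunE.
Qed.

Lemma kapranov_gtP n1 n2 (M : 'M[R]_(n1, n2)) k : (k < kapranov_rank K M)%N <->
  ~ trop R (@minor_ideal n1 n2 K k.+1) (fun ij => M ij.1 ij.2).
Proof.
rewrite /kapranov_rank; case: ex_minnP => r /asboolP rT rmin; split=> [kr kT|kT].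
  by have /rmin : in_trop_minors K M k; [apply/asboolP | rewrite leqNgt kr].
rewrite ltnNge; apply/negP => rk; apply: kT; apply: trop_sub rT => p.
by rewrite -(subnKC rk); elim: (k - r)%N => [|d IHd]; rewrite ?addn0 // addnS => /minor_idealS.
Qed.

Lemma kapranov_embed n1 n2 m1 m2 (M : 'M[R]_(n1, n2)) (M' : 'M[R]_(m1, m2)) k
    (e1 : 'I_n1 -> 'I_m1) (e2 : 'I_n2 -> 'I_m2) :
  (forall i j : 'I_n1, (i < j)%N -> (e1 i < e1 j)%N) ->
  (forall i j : 'I_n2, (i < j)%N -> (e2 i < e2 j)%N) ->
  (forall i j, M' (e1 i) (e2 j) = M i j) ->
  (k < kapranov_rank K M)%N -> (k < kapranov_rank K M')%N.
Proof.
move=> e1inc e2inc eM /kapranov_gtP kM; apply/kapranov_gtP.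
pose h (ij : 'I_n1 * 'I_n2) := (e1 ij.1, e2 ij.2).
(* A degeneration without penalty: [v1] and [mz] vanish, and minors are merely renamed. *)
have [|||c0 Hc] := @notin_trop_degenerate R K _ _ h
   (@minor_gens n1 n2 k.+1) (@minor_gens m1 m2 k.+1) (fun ij => M ij.1 ij.2)
   (fun ij => M' ij.1 ij.2) (fun=> 0) 1 0%MM (oner_neq0 _) _ _ _ kM.
- by case=> i j /=.
- by [].
- move=> _ [f [g [finc ginc ->]]].
  exists (\det (mxsub [ffun i => e1 (f i)] [ffun i => e2 (g i)] (generic_mx m1 m2 K))).
    exists [ffun i => e1 (f i)], [ffun i => e2 (g i)]; split => //.
      apply/forallP => a; apply/forallP => b; apply/implyP => ab; rewrite !ffunE.
      exact/e1inc/(increasing_lt finc).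
    apply/forallP => a; apply/forallP => b; apply/implyP => ab; rewrite !ffunE.
    exact/e2inc/(increasing_lt ginc).
  rewrite mpolyX0 scale1r mul1r -det_map_mx.
  suff -> : map_mx (msubst h) (mxsub f g (generic_mx n1 n2 K)) =
      mxsub [ffun i => e1 (f i)] [ffun i => e2 (g i)] (generic_mx m1 m2 K).
    by rewrite subrr; apply: wlt0.
  by apply/matrixP => a b; rewrite !mxE !ffunE msubst_var.
have {Hc} := Hc c0 (lexx _); congr (~ trop R _ _).
by apply/funext => t; rewrite mulr0 addr0.
Qed.

End Kapranov.

(** * Enlarging a matrix by a corner *)

(** Sends both 0 and 1 to 0 and lowers all other indices by 1: selecting rows by it repeats the
    first row. *)
Definition unlift0 n (i : 'I_n.+2) : 'I_n.+1 := odflt ord0 (unlift ord0 i).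

Lemma unlift0_lift n (i : 'I_n.+1) : unlift0 (lift ord0 i) = i.
Proof. by rewrite /unlift0 liftK. Qed.

Section Corner.
Variables (R : realType) (K : fieldType) (n1 n2 k : nat).
Variable (M : 'M[R]_(n1.+1, n2.+1)).

Definition corner (c : R) : 'M[R]_(n1.+2, n2.+2) :=
  \matrix_(i, j) if (i == ord0) && (j == ord0) then c else M (unlift0 i) (unlift0 j).

Definition ext0 r n (f : {ffun 'I_r -> 'I_n}) : {ffun 'I_r.+1 -> 'I_n.+1} :=
  [ffun i => if unlift ord0 i is Some j then lift ord0 (f j) else ord0].

Lemma ext0_0 r n (f : {ffun 'I_r -> 'I_n}) : ext0 f ord0 = ord0.
Proof. by rewrite ffunE unlift_none. Qed.

Lemma ext0_lift r n (f : {ffun 'I_r -> 'I_n}) i :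
  ext0 f (lift ord0 i) = lift ord0 (f i).
Proof. by rewrite ffunE liftK. Qed.

Lemma ext0_increasing r n (f : {ffun 'I_r -> 'I_n}) :
  increasing f -> increasing (ext0 f).
Proof.
move=> finc; apply/forallP => i; apply/forallP => j; apply/implyP.
case: (unliftP ord0 j) => [j' ->|-> //]; rewrite ext0_lift.
case: (unliftP ord0 i) => [i' ->|->]; rewrite ?ext0_lift ?ext0_0 //.
by rewrite !lift0 !ltnS => /(increasing_lt finc).
Qed.

(** When the corner is heavy, a minor through it is led by the corner variable times the minor on
    the remaining rows and columns. So an ideal element with a monomial initial form survives, with
    minors of one size more. *)
Lemma kapranov_corner : (k < kapranov_rank K M)%N ->
  exists c0, forall c, c0 <= c -> (k.+1 < kapranov_rank K (corner c))%N.
Proof.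
move=> /kapranov_gtP kM.
pose h (ij : 'I_n1.+1 * 'I_n2.+1) := (lift ord0 ij.1, lift ord0 ij.2).
pose z : 'I_n1.+2 * 'I_n2.+2 := (ord0, ord0).
pose v1 ij : R := (ij == z)%:R.
have hz ij : (h ij == z) = false by rewrite -[RHS](lift_eqF ord0 ij.1).
have [|||c0 Hc] := @notin_trop_degenerate R K _ _ h
   (@minor_gens K n1.+1 n2.+1 k.+1) (@minor_gens K n1.+2 n2.+2 k.+2)
   (fun ij => M ij.1 ij.2)
   (fun ij => corner 0 ij.1 ij.2) v1 1 U_(enum_rank z)%MM (oner_neq0 _) _ _ _ kM.
- by case=> i j; rewrite mxE /= !unlift0_lift.
- by move=> ij; rewrite /v1 hz.
- move=> _ [f [g [finc ginc ->]]]; rewrite scale1r mweight1 /v1 eqxx.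
  set A := mxsub (ext0 f) (ext0 g) (generic_mx n1.+2 n2.+2 K).
  exists (\det A).
    by exists (ext0 f), (ext0 g); split => //; apply: ext0_increasing.
  (* Only the corner survives in the first row of [B], and expansion along this row gives the
     product. The entries cleared have [v1]-weight 0, below the potential 1 of the row. *)
  pose B : 'M_(k.+2) := \matrix_(i, j) if (i == ord0) && (j != ord0) then 0 else A i j.
  have -> : 'X_(enum_rank z) * msubst h (\det (mxsub f g (generic_mx n1.+1 n2.+1 K))) = \det B.
    rewrite [RHS](expand_det_row _ ord0) (bigD1 ord0) //= big1 ?addr0 => [|j j0].
      rewrite [B _ _]mxE /= !mxE !ext0_0 /cofactor addn0 expr0 mul1r; congr (_ * _).
      rewrite -det_map_mx; congr (\det _); apply/matrixP => i j.
      by rewrite !mxE /= !ext0_lift msubst_var.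
    by rewrite [B _ _]mxE eqxx j0 mul0r.
  pose u (i : 'I_k.+2) : R := (i == ord0)%:R.
  have -> : true%:R = \sum_i u i + \sum_(j < k.+2) 0.
    by rewrite big1_eq addr0 (bigD1 ord0) //= big1 ?addr0 // => i /negbTE; rewrite /u => ->.
  apply: wlt_det => i j.
    rewrite !mxE addr0; apply: wle_le; last exact: wle_var.
    rewrite /v1 /u /z; case: eqP => [[]|_]; last by rewrite ler0n.
    by case: (unliftP ord0 i) => [i' ->|->]; rewrite ?ext0_lift.
  rewrite [B i j]mxE; case: ifP => [/andP[/eqP -> j0]|_]; last by rewrite subrr; apply: wlt0.
  rewrite subr0 addr0 !mxE; apply: wltX; rewrite mweight1 /v1 /u /z eqxx.
  move: j0; case: (unliftP ord0 j) => [j' ->|->]; rewrite ?eqxx // ext0_lift ext0_0.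
  by rewrite ltr01.
exists c0 => c /Hc {Hc} Hc; apply/kapranov_gtP; move: Hc; congr (~ trop R _ _).
apply/funext => -[i j]; rewrite /v1 /z !mxE xpair_eqE.
by case: ifP => _; rewrite ?mulr1 ?mulr0 ?add0r ?addr0.
Qed.

Lemma tropical_rank_corner : (tropical_rank M <= k)%N ->
  exists c0, forall c, c0 <= c -> (tropical_rank (corner c) <= k.+1)%N.
Proof.
move=> /tropical_rank_leP singM.
(* Three times [N] absorbs the three entries of [M] in the exchange inequality [cM]. *)
pose N := \sum_i \sum_j `|M i j|; exists (N + N + N) => c c0c.
have leN i j : `|M i j| <= N.
  rewrite /N (bigD1 i) // (bigD1 j) //= -addrA lerDl addr_ge0 ?sumr_ge0 // => i' _.
  by rewrite sumr_ge0.
have cM i j i' j' : M i j + M i' j' <= c + M i' j.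
  have := leN i j; have := leN i' j'; have := leN i' j.
  have := ler_norm (M i j); have := ler_norm (M i' j').
  have := ler_norm (- M i' j); rewrite normrN; lra.
apply/tropical_rank_leP => f g finc ginc.
(* Without the corner, the minor is a selection from [M] of size [k + 2], possibly with
   repetitions. *)
have nocorner : (f ord0 != ord0) || (g ord0 != ord0) ->
    tropically_singular (mxsub f g (corner c)).
  move=> fg0; have -> : mxsub f g (corner c) = mxsub (@unlift0 _ \o f) (@unlift0 _ \o g) M.
    apply/matrixP => i j; rewrite !mxE /=; case: ifP => // /andP[/eqP fi0 /eqP gj0].
    have i0 : i = ord0.
      apply/eqP; apply: contraTT isT; rewrite -lt0n => /(increasing_lt finc (i := ord0)).
      by rewrite fi0.
    have j0 : j = ord0.
      apply/eqP; apply: contraTT isT; rewrite -lt0n => /(increasing_lt ginc (i := ord0)).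
      by rewrite gj0.
    by move: fi0 gj0 fg0; rewrite i0 j0 => -> ->; rewrite !eqxx.
  exact/singular_mxsub/singular_minorsS.
have [/nocorner //|] := boolP ((f ord0 != ord0) || (g ord0 != ord0)).
rewrite negb_or !negbK => /andP[/eqP f0 /eqP g0]; apply/tropically_singularP => s.
have fS i : f (lift ord0 i) != ord0.
  by rewrite -lt0n (leq_ltn_trans _ (increasing_lt finc (i := ord0) _)).
have gS i : g (lift ord0 i) != ord0.
  by rewrite -lt0n (leq_ltn_trans _ (increasing_lt ginc (i := ord0) _)).
(* If the permutation uses the corner, improve on the complement, of size [k + 1]. Otherwise
   exchange its entries in the first row and the first column for the corner and the opposite entry,
   without loss by [cM]. *)
have [s0|s0] := eqVneq (s ord0) ord0.
  have [t sE] := lift_perm_decomp s ord0.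
  have /tropically_singularP/(_ t)[t' t't le_tt'] :=
    singular_mxsub (fun i => unlift0 (f (lift ord0 i))) (fun i => unlift0 (g (lift ord0 i))) singM.
  exists (lift_perm ord0 (s ord0) t').
    apply: contraNneq t't => st'.
    apply/eqP/permP => i; apply: (@lift_inj _ (s ord0)).
    by rewrite -!(lift_perm_lift ord0) st' -sE.
  rewrite {1}sE !sum_lift_perm lerD2l s0; apply: le_trans (le_trans _ le_tt') _.
    by apply/eq_ler/eq_bigr => i _; rewrite !mxE (negbTE (fS _)).
  by apply/eq_ler/eq_bigr => i _; rewrite !mxE (negbTE (fS _)).
pose i1 := (s^-1)%g ord0; have si1 : s i1 = ord0 by rewrite /i1 permKV.
have i10 : i1 != ord0 by apply: contraNneq s0 => i10; rewrite -[X in s X]i10 si1.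
exists (tperm ord0 i1 * s)%g.
  apply: contraNneq s0 => /(congr1 (fun t : 'S_k.+2 => t ord0)).
  by rewrite permM tpermL si1 => <-.
rewrite (bigD1 ord0) //= (bigD1 i1) //= [leRHS](bigD1 ord0) //= [X in _ <= _ + X](bigD1 i1) //=.
rewrite !addrA lerD //; last first.
  apply/eq_ler/eq_bigr => i /andP[i0 ii1]; rewrite permM tpermD // eq_sym //.
rewrite !mxE !permM tpermL tpermR si1 f0 g0 !eqxx /=.
have [i2 i2E] : exists i2, i1 = lift ord0 i2.
  by move: i10; case: (unliftP ord0 i1) => [i2 ->|->]; [exists i2 | rewrite eqxx].
have [j2 j2E] : exists j2, s ord0 = lift ord0 j2.
  by move: s0; case: (unliftP ord0 (s ord0)) => [j2 ->|->]; [exists j2 | rewrite eqxx].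
rewrite i2E j2E !(negbTE (fS _)) !(negbTE (gS _)) /=.
exact: cM.
Qed.

End Corner.

(** * The matrices of Fano and Shitov *)

Section SingularCheck.
Variable w : nat -> nat -> nat.

Definition cost (s t p : seq nat) : nat :=
  sumn [seq w (nth 0 s i) (nth 0 t (nth 0 p i)) | i <- iota 0 (size s)].

Definition singular_check r s t : bool :=
  let ps := permutations (iota 0 r) in
  all (fun p => has (fun q => (q != p) && (cost s t q <= cost s t p)%N) ps) ps.

Fixpoint words r n : seq (seq nat) :=
  if r is r'.+1 then [seq x :: s | x <- iota 0 n, s <- words r' n] else [:: [::]].

Definition singular_minors_check r n : bool :=
  let L := filter (sorted ltn) (words r n) in
  all (fun s => all (singular_check r s) L) L.

(** Entries are negated natural numbers, so that singularity is decided by computing in [nat];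
    maximal weight becomes minimal cost. *)
Definition cost_mx (R : realType) n : 'M[R]_n := \matrix_(i, j) - (w i j)%:R.

Lemma mem_words r n (s : seq nat) :
  size s = r -> all (fun x => x < n)%N s -> s \in words r n.
Proof.
elim: r s => [|r IHr] [|x s] //= [sr] /andP[xn sn].
by apply: allpairs_f; rewrite ?mem_iota ?IHr.
Qed.

Definition ord_word r n (f : 'I_r -> 'I_n) : seq nat := [seq val (f i) | i <- enum 'I_r].

Lemma nth_ord_word r n (f : 'I_r -> 'I_n) (i : 'I_r) : nth 0%N (ord_word f) i = f i.
Proof. by rewrite (nth_map i) ?size_enum_ord // nth_ord_enum. Qed.

Lemma size_ord_word r n (f : 'I_r -> 'I_n) : size (ord_word f) = r.
Proof. by rewrite size_map size_enum_ord. Qed.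

Lemma ord_word_increasing r n (f : {ffun 'I_r -> 'I_n}) : increasing f ->
  ord_word f \in filter (sorted ltn) (words r n).
Proof.
move=> finc; rewrite mem_filter mem_words ?size_ord_word // ?andbT; last first.
  by apply/allP => _ /mapP[i _ ->]; apply: ltn_ord.
have : sorted ltn (map val (enum 'I_r)) by rewrite val_enum_ord iota_ltn_sorted.
rewrite !sorted_map; apply: sub_sorted => i j /=; exact: (increasing_lt finc).
Qed.

Lemma perm_ord_word r (s : 'S_r) : ord_word s \in permutations (iota 0 r).
Proof.
rewrite mem_permutations -val_enum_ord /ord_word (map_comp val) perm_map //.
apply: uniq_perm; rewrite ?(map_inj_uniq (@perm_inj _ s)) ?enum_uniq //.
by move=> i; rewrite mem_enum; apply/mapP; exists (s^-1 i)%g; rewrite ?mem_enum ?permKV.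
Qed.

Lemma word_perm r q : q \in permutations (iota 0 r) ->
  exists s : 'S_r, ord_word s = q.
Proof.
rewrite mem_permutations => qP.
have szq : size q = r by rewrite (perm_size qP) size_iota.
have qlt (i : 'I_r) : (nth 0 q i < r)%N.
  have : nth 0%N q i \in iota 0 r by rewrite -(perm_mem qP) mem_nth ?szq.
  by rewrite mem_iota.
have inj : injective (fun i => Ordinal (qlt i)).
  move=> i j /(congr1 val) /= /eqP; rewrite nth_uniq ?szq //; last first.
    by rewrite (perm_uniq qP) iota_uniq.
  by move=> /eqP/val_inj.
exists (perm inj); apply: (@eq_from_nth _ 0%N); rewrite size_ord_word ?szq // => i ir.
by rewrite (nth_ord_word _ (Ordinal ir)) permE.
Qed.

Lemma cost_ord_word r n1 n2 (f : 'I_r -> 'I_n1) (g : 'I_r -> 'I_n2) (s : 'S_r) :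
  cost (ord_word f) (ord_word g) (ord_word s) = (\sum_i w (f i) (g (s i)))%N.
Proof.
rewrite /cost size_ord_word sumnE big_map -[r in iota 0 r]subn0 big_mkord.
by apply: eq_bigr => i _; rewrite !nth_ord_word.
Qed.

Lemma singular_minors_checkP (R : realType) r n :
  singular_minors_check r n -> singular_minors (cost_mx R n) r.
Proof.
move=> /allP chk f g finc ginc.
have /allP/(_ _ (ord_word_increasing ginc))/allP {}chk := chk _ (ord_word_increasing finc).
apply/tropically_singularP => s.
have /hasP[q qP /andP[qs le_qs]] := chk _ (perm_ord_word s).
have [t tq] := word_perm qP; move: le_qs; rewrite -{}tq in qs *.
rewrite !cost_ord_word => le_ts; exists t.
  by apply: contraNneq qs => ->.
have sumE (u : 'S_r) : \sum_i mxsub f g (cost_mx R n) i (u i) =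
    - (\sum_i w (f i) (g (u i)))%:R.
  by rewrite natr_sum -sumrN; apply: eq_bigr => i _; rewrite !mxE.
by rewrite !sumE lerN2 ler_nat.
Qed.

End SingularCheck.

(* [None] stands for 0: skipping the zero entries keeps the expansion short. *)
Fixpoint ldet (A : comNzRingType) r (F : nat -> nat -> option A) : A :=
  if r is r'.+1 then
    foldr (fun j acc => if F 0 j is Some a
        then (-1) ^+ j * a * ldet r' (fun i l => F i.+1 (bump j l)) + acc
        else acc) 0 (iota 0 r)
  else 1.

Lemma det_ldet (A : comNzRingType) r (F : nat -> nat -> option A) :
  \det (\matrix_(i < r, j < r) odflt 0 (F i j)) = ldet r F.
Proof.
elim: r F => [|r IHr] F; first exact: det_mx00.
rewrite (expand_det_row _ ord0).
pose G j := if F 0%N j is Some a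
  then (-1) ^+ j * a * ldet r (fun i l => F i.+1 (bump j l)) else 0.
have -> : ldet r.+1 F = \sum_(j <- iota 0 r.+1) G j.
  rewrite [LHS]/(foldr _ _ _); elim: (iota _ _) => [|j s IHs]; first by rewrite big_nil.
  by rewrite big_cons /= IHs /G; case: (F 0%N j) => [a|]; rewrite ?add0r.
rewrite -[iota _ _]/(index_iota 0 r.+1) big_mkord; apply: eq_bigr => j _.
rewrite mxE /G /=; case: (F 0%N j) => [a|] /=; last by rewrite mul0r.
rewrite /cofactor add0n mulrCA mulrA -IHr; congr (_ * \det _).
by apply/matrixP => i l; rewrite !mxE.
Qed.

(** * Certificates for large Kapranov rank *)

Section Certificate.
Variables (R : realType) (K : fieldType) (w : nat -> nat -> nat) (n r d : nat).

Let y (i j : nat) : {mpoly K[#|{: 'I_n.+1 * 'I_n.+1}|]} := mvar (inord i, inord j).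

Definition monomial (A : comNzRingType) (y : nat -> nat -> A) (l : seq (nat * nat)) :=
  foldr (fun p acc => y p.1 p.2 * acc) 1 l.

Definition wsum (l : seq (nat * nat)) := sumn [seq w p.1 p.2 | p <- l].

(* The potentials are to satisfy [pot_r i <= w i j + pot_c j]: by [wlt_det], the
   leading part of the minor only involves the entries with equality. *)
Record item := Item {negative : bool; multiplier : seq (nat * nat);
  rows : seq nat; cols : seq nat; pot_r : seq nat; pot_c : seq nat}.

Definition tight it i j :=
  nth 0%N (pot_r it) i == (w (nth 0 (rows it) i) (nth 0 (cols it) j) + nth 0 (pot_c it) j)%N.

(** Generic in the ring and in the entries: identities between such expressions are proved by [ring]
    and then applied to the variables of the polynomial ring. *)
Definition item_top (A : comNzRingType) (y : nat -> nat -> A) it :=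
  (-1) ^+ negative it * monomial y (multiplier it) *
  ldet r (fun i j => if tight it i j
                     then Some (y (nth 0%N (rows it) i) (nth 0%N (cols it) j)) else None).

(** The potentials are feasible for the dual of an assignment problem. The last condition says that
    the bound they give on the weight of multiplier times minor is the common value [- d]. *)
Definition item_check it : bool :=
  [&& sorted ltn (rows it), sorted ltn (cols it),
      size (rows it) == r, size (cols it) == r,
      all (fun i => i <= n)%N (rows it), all (fun i => i <= n)%N (cols it),
      size (pot_r it) == r, size (pot_c it) == r,
      all (fun p => (p.1 <= n) && (p.2 <= n))%N (multiplier it),
      all (fun i => all (fun j => nth 0 (pot_r it) i <=
        w (nth 0 (rows it) i) (nth 0 (cols it) j) + nth 0 (pot_c it) j)%N (iota 0 r)) (iota 0 r)
    & (wsum (multiplier it) + sumn (pot_r it) == d + sumn (pot_c it))%N].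

Let v (ij : 'I_n.+1 * 'I_n.+1) : R := cost_mx w R n.+1 ij.1 ij.2.

Lemma vE i j : (i <= n)%N -> (j <= n)%N -> v (inord i, inord j) = - (w i j)%:R.
Proof. by move=> il jl; rewrite /v mxE !inordK. Qed.

Lemma monomialX l : all (fun p => (p.1 <= n) && (p.2 <= n))%N l ->
  exists2 m, monomial y l = 'X_[m] & mweight v m = - (wsum l)%:R.
Proof.
elim: l => [|[i j] l IHl] /=; first by exists 0%MM; rewrite ?mpolyX0 ?mweight0 ?oppr0.
move=> /andP[/andP[il jl] /IHl[m mE mw]].
exists (U_(enum_rank (inord i : 'I_n.+1, inord j : 'I_n.+1)) + m)%MM.
  by rewrite mpolyXD mE.
by rewrite mweightD mweight1 vE // mw /wsum /= natrD opprD.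
Qed.

Lemma word_increasing s : sorted ltn s -> size s = r -> all (fun i => i <= n)%N s ->
  increasing [ffun i : 'I_r => inord (nth 0%N s i) : 'I_n.+1].
Proof.
move=> s_lt s_r /allP s_n; apply/forallP => i; apply/forallP => j; apply/implyP => ij.
rewrite !ffunE !inordK ?ltnS ?s_n ?mem_nth ?s_r //.
apply: (sorted_ltn_nth ltn_trans) => //; by rewrite inE s_r.
Qed.

Lemma sumn_nth s : size s = r -> sumn s = (\sum_(i < r) nth 0%N s i)%N.
Proof. by move=> <-; rewrite sumnE (big_nth 0%N) big_mkord. Qed.

Lemma item_lift it : item_check it -> exists2 f, ideal_gen (@minor_gens K n.+1 n.+1 r) f
  & wlt v (- d%:R) (f - item_top y it).
Proof.
rewrite /item_check; case: it => neg mul rs cs pr pc /= /and5P[rs_lt cs_lt /eqP rs_r /eqP cs_r].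
move=> /and5P[rs_n cs_n /eqP pr_r /eqP pc_r /and3P[mul_n pot /eqP dE]].
pose f := [ffun i : 'I_r => inord (nth 0%N rs i) : 'I_n.+1].
pose g := [ffun i : 'I_r => inord (nth 0%N cs i) : 'I_n.+1].
pose A := mxsub f g (generic_mx n.+1 n.+1 K).
exists ((-1) ^+ neg * monomial y mul * \det A).
  by apply/ideal_genM/ideal_gen_gen; exists f, g; split=> //; apply: word_increasing.
rewrite /item_top -det_ldet -mulrBr.
have -> : - d%:R = (0 + - (wsum mul)%:R) +
    (\sum_(i < r) - (nth 0%N pr i)%:R + \sum_(j < r) (nth 0%N pc j)%:R) :> R.
  rewrite sumrN -!natr_sum -!sumn_nth // add0r; have := congr1 (GRing.natmul 1 : nat -> R) dE.
  rewrite !natrD; lra.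
apply: wlt_mul.
  apply: wleM; first exact: wle_sign.
  by have [m -> <-] := monomialX mul_n; apply: wleX.
have rs_le i : (i < r)%N -> (nth 0 rs i <= n)%N.
  by move=> ir; apply: (allP rs_n); rewrite mem_nth ?rs_r.
have cs_le i : (i < r)%N -> (nth 0 cs i <= n)%N.
  by move=> ir; apply: (allP cs_n); rewrite mem_nth ?cs_r.
have AE i j : A i j = y (nth 0%N rs i) (nth 0%N cs j) by rewrite !mxE !ffunE.
have potE (i j : 'I_r) : (nth 0 pr i <= w (nth 0 rs i) (nth 0 cs j) + nth 0 pc j)%N.
  have ir : nat_of_ord i \in iota 0 r by rewrite mem_iota ltn_ord.
  apply: (allP (allP pot _ ir)).
  by rewrite mem_iota ltn_ord.
apply: wlt_det => i j.
  rewrite AE; apply: wle_le; last exact: wle_var.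
  rewrite vE ?rs_le ?cs_le //; have := potE i j; rewrite -(ler_nat R) natrD; lra.
rewrite AE mxE /tight /=; case: eqP => [_|/eqP ne]; first by rewrite subrr; apply: wlt0.
rewrite /= subr0; apply: wltX; rewrite mweight1 vE ?rs_le ?cs_le //.
have : (nth 0 pr i < w (nth 0 rs i) (nth 0 cs j) + nth 0 pc j)%N by rewrite ltn_neqAle ne potE.
rewrite -(ltr_nat R) natrD; lra.
Qed.

(** The tops add up to [c] times a monomial of weight [- d], and all that was cut off is lighter; so
    the combination of minors has this monomial as initial form, up to the nonzero scalar [c]. *)
Lemma certificate_notin_trop (its : seq item) (l : seq (nat * nat)) (c : nat) :
  all item_check its -> all (fun p => (p.1 <= n) && (p.2 <= n))%N l ->
  wsum l = d -> (c%:R : K) != 0 ->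
  foldr (fun it acc => item_top y it + acc) 0 its = monomial y l *+ c ->
  ~ trop R (@minor_ideal n.+1 n.+1 K r) v.
Proof.
move=> its_ok l_n ld c0 topE; have [m mE mw] := monomialX l_n.
have [f If fE] : exists2 f, ideal_gen (@minor_gens K n.+1 n.+1 r) f
    & wlt v (- d%:R) (f - foldr (fun it acc => item_top y it + acc) 0 its).
  elim: its its_ok {topE} => [_|it its IHits /andP[/item_lift[f' If' f'E] /IHits[f If fE]]].
    by exists 0; [apply: ideal_gen0 | rewrite subrr; apply: wlt0].
  exists (f' + f); first exact: ideal_genD.
  by rewrite /= opprD addrACA; apply: wltD.
apply: (notin_trop c0 If (m := m)).
by rewrite mw ld scaler_nat -mE -topE.
Qed.

End Certificate.

Definition table (t : seq (seq nat)) i j := nth 0%N (nth [::] t i) j.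

(** Row [i] has cost 1 on the line {1, 2, 4} + i modulo 7 of the Fano plane and cost 0 on its
    complement, a cocircuit. *)
Definition fano_cost := table
  [:: [:: 0; 1; 1; 0; 1; 0; 0];
      [:: 0; 0; 1; 1; 0; 1; 0];
      [:: 0; 0; 0; 1; 1; 0; 1];
      [:: 1; 0; 0; 0; 1; 1; 0];
      [:: 0; 1; 0; 0; 0; 1; 1];
      [:: 1; 0; 1; 0; 0; 0; 1];
      [:: 1; 1; 0; 1; 0; 0; 0]]%N.

Definition shitov_cost := table
  [:: [:: 0; 0; 4; 4; 4; 4];
      [:: 0; 0; 2; 4; 1; 4];
      [:: 4; 4; 0; 0; 4; 4];
      [:: 2; 4; 0; 0; 2; 4];
      [:: 4; 4; 4; 4; 0; 0];
      [:: 2; 4; 1; 4; 0; 0]]%N.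

Lemma fano_tropical_rank (R : realType) : (tropical_rank (cost_mx fano_cost R 7) <= 3)%N.
Proof. by apply/tropical_rank_leP/singular_minors_checkP; vm_compute. Qed.

Lemma shitov_tropical_rank (R : realType) : (tropical_rank (cost_mx shitov_cost R 6) <= 4)%N.
Proof. by apply/tropical_rank_leP/singular_minors_checkP; vm_compute. Qed.

Definition zero_potentials := [:: 0; 0; 0; 0]%N.

(** With zero potentials, only entries of cost 0 enter the leading parts. The multipliers make all
    monomials cancel but one, which remains with coefficient 2. *)
Definition fano_items :=
  [:: Item false [:: (1, 0); (3, 6); (4, 0); (5, 3); (6, 5)] [:: 0; 1; 2; 3] [:: 0; 1; 2; 4] zero_potentials zero_potentials;
      Item false [:: (1, 0); (1, 4); (2, 2); (3, 1); (4, 0)] [:: 0; 3; 5; 6] [:: 0; 3; 5; 6] zero_potentials zero_potentials;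
      Item true [:: (0, 0); (1, 4); (3, 1); (4, 0); (6, 6)] [:: 1; 2; 3; 5] [:: 0; 2; 3; 5] zero_potentials zero_potentials;
      Item true [:: (0, 0); (1, 0); (1, 4); (3, 2); (5, 3)] [:: 2; 3; 4; 6] [:: 0; 1; 5; 6] zero_potentials zero_potentials]%N.

Definition fano_monomial :=
  [:: (0, 0); (1, 0); (1, 4); (2, 1); (3, 2); (3, 6); (4, 0); (5, 3); (6, 5)]%N.

Lemma fano_identity (A : comNzRingType) (y : nat -> nat -> A) :
  foldr (fun it acc => item_top fano_cost 4 y it + acc) 0 fano_items =
  monomial y fano_monomial *+ 2.
Proof. rewrite /item_top /monomial /=; ring. Qed.

(** Two minors of size 5 suffice; the surviving monomial, of cost 4, has coefficient 1, so this
    certificate is valid over every field. *)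
Definition shitov_items :=
  [:: Item false [:: (1, 1); (2, 3); (3, 0)] [:: 0; 1; 3; 4; 5] [:: 1; 2; 3; 4; 5]
        [:: 2; 2; 0; 1; 1] [:: 2; 0; 0; 1; 1];
      Item true [:: (0, 1); (1, 2); (3, 3)] [:: 1; 2; 3; 4; 5] [:: 0; 1; 3; 4; 5]
        [:: 0; 2; 2; 2; 2] [:: 0; 0; 2; 2; 2]]%N.

Definition shitov_monomial :=
  [:: (0, 1); (1, 1); (1, 4); (2, 3); (3, 0); (3, 3); (4, 5); (5, 2)]%N.

Lemma shitov_identity (A : comNzRingType) (y : nat -> nat -> A) :
  foldr (fun it acc => item_top shitov_cost 5 y it + acc) 0 shitov_items =
  monomial y shitov_monomial *+ 1.
Proof. rewrite /item_top /monomial /=; ring. Qed.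

(** The coefficient 2 of the certificate rules out characteristic 2, where the Fano plane is
    representable. *)
Lemma fano_kapranov_rank (R : realType) (K : fieldType) : (2%:R : K) != 0 ->
  (3 < kapranov_rank K (cost_mx fano_cost R 7))%N.
Proof.
move=> two_neq0; apply/kapranov_gtP.
by apply: (@certificate_notin_trop R K fano_cost 6 4 0 fano_items fano_monomial 2) => //;
  apply: fano_identity.
Qed.

Lemma shitov_kapranov_rank (R : realType) (K : fieldType) :
  (4 < kapranov_rank K (cost_mx shitov_cost R 6))%N.
Proof.
apply/kapranov_gtP.
apply: (@certificate_notin_trop R K shitov_cost 5 5 4 shitov_items shitov_monomial 1) => //.
  exact: oner_neq0.
exact: shitov_identity.
Qed.

(** * Exchanges in perfect matchings *)

Section Matchings.
Variable n : nat.
Implicit Types (U : {set 'I_n}) (E : {set edge n}) (e f : edge n) (u w x : 'I_n).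

Definition mdeg E u := #|[set e in E | incident u e]|.

(** Both conditions become one equation of degrees, with the boolean read as 0 or 1. Exchanges of
    edges are then checked by counting at each vertex. *)
Lemma perfect_matchingP U E :
  reflect (forall u, mdeg E u = (u \in U)) (perfect_matching U E).
Proof.
apply: (iffP andP) => [[/forallP EU /forallP deg1] u|degE].
  have [uU|uU] := boolP (u \in U).
    by have /implyP/(_ uU)/eqP := deg1 u.
  apply/eqP; rewrite cards_eq0; apply/eqP/setP => e; rewrite !inE.
  apply/negP => /andP[eE ue]; have /implyP/(_ eE)/forallP/(_ u)/implyP/(_ ue) := EU e.
  by rewrite (negbTE uU).
split; last by apply/forallP => u; apply/implyP => uU; rewrite -/(mdeg E u) degE uU.
apply/forallP => e; apply/implyP => eE; apply/forallP => u; apply/implyP => ue.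
have : (0 < mdeg E u)%N by apply/card_gt0P; exists e; rewrite inE eE.
by rewrite degE; case: (u \in U).
Qed.

Lemma mdegU1 e E u : e \notin E -> mdeg (e |: E) u = (incident u e + mdeg E u)%N.
Proof.
move=> eE; rewrite /mdeg; have [ue|ue] := boolP (incident u e).
  have -> : [set f in e |: E | incident u f] = e |: [set f in E | incident u f].
    by apply/setP => f; rewrite !inE; case: eqP => [->|].
  by rewrite cardsU1 inE (negbTE eE).
apply: eq_card => f; rewrite !inE; case: eqP => [->|//].
by rewrite (negbTE ue) !andbF.
Qed.

Lemma mdegD1 e E u : e \in E -> mdeg E u = (incident u e + mdeg (E :\ e) u)%N.
Proof. by move=> eE; rewrite -[in LHS](@finset.setD1K _ e E eE) mdegU1 // !inE eqxx. Qed.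

Lemma matching_uniq U E e f u : perfect_matching U E -> e \in E -> f \in E ->
  incident u e -> incident u f -> e = f.
Proof.
move=> /perfect_matchingP deg eE fE ue uf; apply/eqP; apply: contraT => ef.
have := deg u; rewrite (mdegD1 u eE) (@mdegD1 f) ?ue ?uf; last by rewrite !inE eq_sym ef.
by case: (u \in U).
Qed.

Lemma matching_incident U E u : perfect_matching U E -> u \in U ->
  exists2 e, e \in E & incident u e.
Proof.
move=> /perfect_matchingP deg uU; have : (0 < mdeg E u)%N by rewrite deg uU.
by case/card_gt0P => e; rewrite inE => /andP[]; exists e.
Qed.

Lemma matching_mem U E e u : perfect_matching U E -> e \in E -> incident u e -> u \in U.
Proof.
move=> /perfect_matchingP deg eE ue; have := deg u; rewrite (mdegD1 u eE) ue.
by case: (u \in U).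
Qed.

Definition joins e u w := (val e == (u, w)) || (val e == (w, u)).

Lemma joins_sym e u w : joins e u w = joins e w u.
Proof. by rewrite /joins orbC. Qed.

Lemma joins_ex u w : u != w -> exists e, joins e u w.
Proof.
rewrite -val_eqE /= neq_ltn => /orP[uw|wu].
  by exists (Sub (u, w) uw); rewrite /joins SubK eqxx.
by exists (Sub (w, u) wu); rewrite /joins SubK eqxx orbT.
Qed.

Lemma joins_val e : joins e (val e).1 (val e).2.
Proof. by rewrite /joins -surjective_pairing eqxx. Qed.

Lemma joins_incident e u w x : joins e u w -> incident x e = (x == u) || (x == w).
Proof. by rewrite /joins /incident => /orP[]/eqP -> //=; rewrite orbC. Qed.

Lemma joins_neq e u w : joins e u w -> u != w.
Proof.
have := valP e; rewrite /joins => e_lt /orP[]/eqP eE; rewrite eE /= in e_lt.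
  by rewrite -val_eqE neq_ltn e_lt.
by rewrite -val_eqE neq_ltn e_lt orbT.
Qed.

Lemma joins_incidentN e u w x : joins e u w ->
  (incident x e = (x == u) + (x == w) :> nat)%N.
Proof.
move=> euw; rewrite (joins_incident x euw); have := joins_neq euw.
by case: (eqVneq x u) => [->|_]; [case: eqP | case: eqP].
Qed.

Lemma incident_joins e u : incident u e -> exists w, joins e u w.
Proof.
case/orP=> /eqP ->; [exists (val e).2 | exists (val e).1; rewrite joins_sym].
  exact: joins_val.
exact: joins_val.
Qed.

Lemma joins_inj e f u w : joins e u w -> joins f u w -> e = f.
Proof.
have := valP e; have := valP f; rewrite /joins => f_lt e_lt eE fE; apply: val_inj.
case/orP: eE fE => /eqP eE /orP[]/eqP fE; rewrite eE fE // in e_lt f_lt *; move: e_lt f_lt => /=.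
  by move=> /ltn_trans e_lt /e_lt; rewrite ltnn.
by move=> /ltn_trans e_lt /e_lt; rewrite ltnn.
Qed.

Section Weight.
Variables (R : realType) (W : 'I_n -> 'I_n -> R).
Hypothesis Wsym : forall u w, W u w = W w u.
Definition edge_weight e := W (val e).1 (val e).2.

Lemma edge_weight_joins e u w : joins e u w -> edge_weight e = W u w.
Proof. by rewrite /joins /edge_weight => /orP[]/eqP -> /=. Qed.

(** Only the degrees at [i] and [h] change, so the matched set trades [i] for [h]. *)
Lemma matching_retarget U E e e' i j h : perfect_matching U E -> e \in E ->
  joins e i j -> joins e' j h -> h \notin U ->
  [/\ perfect_matching (h |: (U :\ i)) (e' |: (E :\ e)), e' \notin E
    & \sum_(x in e' |: (E :\ e)) edge_weight x
      = \sum_(x in E) edge_weight x - W i j + W j h].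
Proof.
move=> pmE eE eij ejh hU.
have e'E : e' \notin E.
  apply: contra hU => e'E; apply: matching_mem pmE e'E _.
  by rewrite (joins_incident _ ejh) eqxx orbT.
have e'D : e' \notin E :\ e by rewrite !inE (negbTE e'E) andbF.
have iU : i \in U by apply: matching_mem pmE eE _; rewrite (joins_incident _ eij) eqxx.
split=> //; last first.
  rewrite big_setU1 //= (big_setD1 e eE) /= (edge_weight_joins eij) (edge_weight_joins ejh).
  by rewrite addrC [W i j + _]addrC addrK.
apply/perfect_matchingP => x; rewrite mdegU1 //.
have := perfect_matchingP _ _ pmE x; rewrite (mdegD1 x eE).
rewrite (joins_incidentN _ eij) (joins_incidentN _ ejh) !inE.
have [->|xh] := eqVneq x h.
  rewrite (negbTE hU); have -> : (h == i) = false by apply: contraNF hU => /eqP ->.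
  by case: (mdeg _ _) => //; case: (h == j).
have [->|xi] := eqVneq x i; last by rewrite !add0n addn0 => ->.
by rewrite iU; case: (mdeg _ _) => //; case: (i == j).
Qed.

(** Edges of a matching are disjoint, so the four endpoints are distinct and the new pairs are
    edges. They are not in [E], whose edges at [i] and [j] are unique, and all degrees are kept. *)
Lemma matching_swap U E e f i j p q : perfect_matching U E -> e \in E -> f \in E ->
  e != f -> joins e i j -> joins f p q ->
  exists E', [/\ perfect_matching U E', E' != E
    & \sum_(x in E') edge_weight x
      = \sum_(x in E) edge_weight x - W i j - W p q + W i p + W j q].
Proof.
move=> pmE eE fE ef eij fpq.
have disj x : incident x e -> incident x f -> False.
  by move=> xe xf; rewrite (matching_uniq pmE eE fE xe xf) eqxx in ef.
have ie x : incident x e = (x == i) || (x == j) := joins_incident x eij.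
have if_ x : incident x f = (x == p) || (x == q) := joins_incident x fpq.
have ip : i != p by apply/eqP => ip; apply: (disj i); rewrite ?ie ?if_ ?ip eqxx.
have jq : j != q by apply/eqP => jq; apply: (disj j); rewrite ?ie ?if_ ?jq eqxx orbT.
have iq : i != q by apply/eqP => iq; apply: (disj i); rewrite ?ie ?if_ ?iq eqxx ?orbT.
have [e' e'ip] := joins_ex ip; have [f' f'jq] := joins_ex jq.
have ie' x : incident x e' = (x == i) || (x == p) := joins_incident x e'ip.
have if' x : incident x f' = (x == j) || (x == q) := joins_incident x f'jq.
have ij := joins_neq eij; have pq := joins_neq fpq.
have e'E : e' \notin E.
  apply/negP => e'E; have : e' = e by apply: (matching_uniq pmE e'E eE (u := i)); rewrite ?ie' ?ie eqxx.
  move=> e'e; apply: (disj p); last by rewrite if_ eqxx.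
  by rewrite -e'e ie' eqxx orbT.
have f'E : f' \notin E.
  apply/negP => f'E; have : f' = e by apply: (matching_uniq pmE f'E eE (u := j)); rewrite ?if' ?ie eqxx ?orbT.
  move=> f'e; apply: (disj q); last by rewrite if_ eqxx orbT.
  by rewrite -f'e if' eqxx orbT.
have e'f' : e' != f'.
  apply/eqP => e'f'; have := if' i; rewrite -e'f' ie' eqxx (negbTE ij) /=.
  by rewrite (negbTE iq).
have fD : f \in E :\ e by rewrite !inE eq_sym ef.
have f'D : f' \notin E :\ e :\ f by rewrite !inE (negbTE f'E) !andbF.
have e'D : e' \notin f' |: (E :\ e :\ f).
  by rewrite !inE (negbTE e'E) (negbTE e'f') !andbF.
exists (e' |: (f' |: (E :\ e :\ f))); split.
- apply/perfect_matchingP => x; rewrite !mdegU1 //.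
  have := perfect_matchingP _ _ pmE x; rewrite (mdegD1 x eE) (mdegD1 x fD) => <-.
  rewrite (joins_incidentN x eij) (joins_incidentN x fpq) (joins_incidentN x e'ip).
  by rewrite (joins_incidentN x f'jq) !addnA; congr (_ + _ + _)%N; apply: addnAC.
- by apply/eqP => E'E; rewrite -E'E !inE eqxx in e'E.
rewrite !big_setU1 //= (big_setD1 e eE) (big_setD1 f fD) /=.
rewrite (edge_weight_joins eij) (edge_weight_joins fpq) (edge_weight_joins e'ip).
rewrite (edge_weight_joins f'jq) addrA [W i j + _]addrC -!addrA; lra.
Qed.

End Weight.

Lemma perfect_matching_ex r U : #|U| = r.*2 -> exists E, perfect_matching U E.
Proof.
elim: r U => [|r IHr] U cU.
  exists finset.set0; apply/perfect_matchingP => u; rewrite (cards0_eq cU) inE.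
  by apply/eqP; rewrite cards_eq0; apply/eqP/setP => e; rewrite !inE.
have [i iU] : exists i, i \in U by apply/card_gt0P; rewrite cU.
have [j jU] : exists j, j \in U :\ i.
  by apply/card_gt0P; move: cU; rewrite (cardsD1 i) iU doubleS add1n => -[->].
have ij : i != j by move: jU; rewrite !inE eq_sym => /andP[].
have [|E pmE] := IHr (U :\ i :\ j).
  by move: cU; rewrite (cardsD1 i) iU (cardsD1 j (U :\ i)) jU doubleS => -[].
have [e eij] := joins_ex ij; exists (e |: E).
have eE : e \notin E.
  apply/negP => /(matching_mem pmE) => /(_ i); rewrite (joins_incident _ eij) eqxx.
  by move=> /(_ isT); rewrite !inE eqxx andbF.
apply/perfect_matchingP => x; rewrite mdegU1 // (perfect_matchingP _ _ pmE).
rewrite (joins_incidentN x eij) !inE; move: jU; rewrite !inE => /andP[_ jU].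
have [->|xj] := eqVneq x j; first by rewrite jU eq_sym (negbTE ij).
by have [->|xi] := eqVneq x i; rewrite ?iU // andbT.
Qed.

End Matchings.

(** * Bipartite matchings *)

Section Inversions.
Variable r : nat.
Implicit Type s : 'S_r.

(** Rows precede columns in the vertex order, so two edges of a bipartite matching cross exactly
    when the permutation keeps the order of their rows. *)
Definition noninversions s :=
  #|[set ij : 'I_r * 'I_r | (ij.1 < ij.2)%N && (s ij.1 < s ij.2)%N]|.

(** Both sides are Vandermonde determinants, and [s] permutes the columns. *)
Lemma prod_perm_diff s :
  \prod_(i < r) \prod_(j < r | (i < j)%N) ((s j)%:Z - (s i)%:Z) =
  (-1) ^+ s * \prod_(i < r) \prod_(j < r | (i < j)%N) (j%:Z - i%:Z) :> int.
Proof.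
have VE (t : 'S_r) : \prod_(i < r) \prod_(j < r | (i < j)%N) ((t j)%:Z - (t i)%:Z) =
    \det (Vandermonde r (\row_j (t j)%:Z)).
  rewrite det_Vandermonde; apply: eq_bigr => i _; apply: eq_bigr => j _.
  by rewrite !mxE.
pose V := Vandermonde r (\row_(j < r) (j : nat)%:Z).
rewrite VE; have -> : Vandermonde r (\row_j (s j)%:Z) = col_perm s V.
  by apply/matrixP => i j; rewrite !mxE.
rewrite col_permE det_mulmx det_perm odd_permV mulrC; congr (_ * _).
by rewrite det_Vandermonde; apply: eq_bigr => i _; apply: eq_bigr => j _; rewrite !mxE.
Qed.

Definition inversions s := (\sum_(i < r) \sum_(j < r | (i < j)%N) (s j < s i)%N)%N.

(* Compare the signs of the two Vandermonde products. *)
Lemma odd_inversions s : odd (inversions s) = s.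
Proof.
have sgE (t : 'S_r) : Num.sg (\prod_(i < r) \prod_(j < r | (i < j)%N) ((t j)%:Z - (t i)%:Z))
    = (-1) ^+ inversions t.
  rewrite (big_morph _ (@sgrM _) (@sgr1 _)) /inversions -prodrXr.
  apply: eq_bigr => i _; rewrite (big_morph _ (@sgrM _) (@sgr1 _)) -prodrXr.
  apply: eq_bigr => j ij; have : t i != t j.
    by rewrite (inj_eq perm_inj) -val_eqE neq_ltn ij.
  rewrite -val_eqE neq_ltn => /orP[lt_t|lt_t].
    by rewrite gtr0_sg ?subr_gt0 ?ltz_nat // ltnNge (ltnW lt_t).
  by rewrite lt_t ltr0_sg // subr_lt0 ltz_nat.
have := congr1 Num.sg (prod_perm_diff s); rewrite sgE sgrM.
have := sgE 1%g; under eq_bigr => i _ do under eq_bigr => j _ do rewrite !perm1.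
move=> ->; have -> : inversions 1 = 0%N.
  rewrite /inversions big1 // => i _; rewrite big1 // => j ij.
  by rewrite !perm1 ltnNge (ltnW ij).
rewrite mulr1 -signr_odd.
by case: (odd _); case: (odd_perm s).
Qed.

Lemma noninversionsE s : (noninversions s + inversions s = noninversions 1)%N.
Proof.
have nE (t : 'S_r) : noninversions t =
    (\sum_(i < r) \sum_(j < r | (i < j)%N) (t i < t j)%N)%N.
  rewrite pair_big_dep /= /noninversions -sum1dep_card big_mkcondr /=.
  by apply: eq_bigr => -[i j] _ /=; case: ltnP.
rewrite !nE /inversions -big_split; apply: eq_bigr => i _ /=.
rewrite -big_split; apply: eq_bigr => j ij /=; rewrite !perm1 ij.
have : s i != s j by rewrite (inj_eq perm_inj) -val_eqE neq_ltn ij.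
by rewrite -val_eqE; case: ltngtP.
Qed.

(** Inversions and noninversions add up to a constant, so the crossing sign is the sign of the
    permutation up to a global factor. *)
Lemma sign_noninversions (A : nzRingType) s :
  (-1) ^+ noninversions s = (-1) ^+ noninversions 1 * (-1) ^+ s :> A.
Proof.
rewrite -(noninversionsE s) exprD -odd_inversions signr_odd -mulrA -expr2.
by rewrite sqrr_sign mulr1.
Qed.

End Inversions.

Section Bipartite.
Variables n1 n2 : nat.

Lemma cross_edge_lt (a : 'I_n1) (b : 'I_n2) :
  ((lshift n2 a, rshift n1 b).1 < (lshift n2 a, rshift n1 b).2)%N.
Proof. by rewrite /= ltn_addr. Qed.

Definition bip_edge a b : edge (n1 + n2) := Sub (_, _) (cross_edge_lt a b).

Definition bipartite (e : edge (n1 + n2)) : bool :=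
  ((val e).1 < n1 <= (val e).2)%N.

Lemma bipartite_edge a b : bipartite (bip_edge a b).
Proof. by rewrite /bipartite /= ltn_ord leq_addr. Qed.


Lemma bip_edge_inj a b a' b' : bip_edge a b = bip_edge a' b' -> a = a' /\ b = b'.
Proof. by move=> /(congr1 val) [/val_inj-> /addnI/val_inj ->]. Qed.

Lemma bipartiteP e : bipartite e -> exists a b, e = bip_edge a b.
Proof.
case: e => -[u w] /= uw; rewrite /bipartite /=; case: (split_ordP u) uw => a ->; last first.
  by move=> uw /andP[].
case: (split_ordP w) => b -> uw; first by move=> /andP[_ /=]; rewrite leqNgt ltn_ord.
by move=> _; exists a, b; apply: val_inj.
Qed.

Lemma joins_bip_edge a b : joins (bip_edge a b) (lshift n2 a) (rshift n1 b).
Proof. by rewrite /joins /= eqxx. Qed.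

Section Minor.
Variables (r : nat) (f : 'I_r -> 'I_n1) (g : 'I_r -> 'I_n2).
Hypotheses (finj : injective f) (ginj : injective g).
Implicit Type s : 'S_r.

Definition minor_vertices : {set 'I_(n1 + n2)} :=
  [set lshift n2 (f i) | i : 'I_r] :|: [set rshift n1 (g i) | i : 'I_r].

Definition perm_edge s i := bip_edge (f i) (g (s i)).
Definition perm_matching s : {set edge (n1 + n2)} := [set perm_edge s i | i : 'I_r].

Lemma perm_edge_inj s : injective (perm_edge s).
Proof. by move=> i j /bip_edge_inj[/finj]. Qed.

Lemma card_minor_vertices : #|minor_vertices| = r.*2.
Proof.
rewrite cardsU card_imset ?card_imset ?card_ord; first last.
- by move=> i j /lshift_inj/finj.
- by move=> i j /rshift_inj/ginj.
rewrite (_ : _ :&: _ = finset.set0) ?cards0 ?subn0 ?addnn //.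
apply/setP => u; rewrite !inE; apply/negP => /andP[/imsetP[i _ ->] /imsetP[j _]].
by move/eqP; rewrite eq_lrshift.
Qed.

Lemma perm_matching_perfect s : perfect_matching minor_vertices (perm_matching s).
Proof.
apply/andP; split.
  apply/forallP => e; apply/implyP => /imsetP[i _ ->]; apply/forallP => u; apply/implyP.
  rewrite (joins_incident u (joins_bip_edge _ _)) inE => /orP[]/eqP ->.
    by rewrite (imset_f (fun i => lshift n2 (f i))).
  by rewrite (imset_f (fun i => rshift n1 (g i))) ?orbT.
have single u i : incident u (perm_edge s i) ->
    (forall j, incident u (perm_edge s j) -> j = i) ->
    #|[set e in perm_matching s | incident u e]| == 1%N.
  move=> ui uniq_i; apply/cards1P; exists (perm_edge s i); apply/setP => e; rewrite !inE.
  apply/andP/eqP => [[/imsetP[j _ ->] /uniq_i ->]//|->].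
  by split=> //; apply: imset_f.
apply/forallP => u; apply/implyP; rewrite inE => /orP[]/imsetP[i _ ->].
  apply: (single _ i); first by rewrite (joins_incident _ (joins_bip_edge _ _)) eqxx.
  move=> j; rewrite (joins_incident _ (joins_bip_edge _ _)) eq_lrshift orbF.
  by rewrite eq_lshift => /eqP/finj.
apply: (single _ (s^-1 i)%g).
  by rewrite (joins_incident _ (joins_bip_edge _ _)) permKV eqxx orbT.
move=> j; rewrite (joins_incident _ (joins_bip_edge _ _)) eq_rlshift /= eq_rshift.
by move=> /eqP/ginj ->; rewrite permK.
Qed.

Lemma perm_matching_bipartite s e : e \in perm_matching s -> bipartite e.
Proof. by case/imsetP => i _ ->; apply: bipartite_edge. Qed.

Lemma perm_matching_inj : injective perm_matching.
Proof.
move=> s t st; apply/permP => i.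
have : perm_edge s i \in perm_matching t by rewrite -st imset_f.
by case/imsetP => j _ /bip_edge_inj[/finj -> /ginj].
Qed.

(** Every row has a partner among the columns, and disjointness of the edges makes the partner map
    injective. *)
Lemma perm_matching_surj (E : {set edge (n1 + n2)}) :
  perfect_matching minor_vertices E -> (forall e, e \in E -> bipartite e) ->
  exists s, E = perm_matching s.
Proof.
move=> pmE bipE.
have ex i : exists j, bip_edge (f i) (g j) \in E.
  have [|e eE ie] := matching_incident pmE (u := lshift n2 (f i)).
    by rewrite inE (imset_f (fun i => lshift n2 (f i))).
  have [a [b eab]] := bipartiteP (bipE e eE); subst e; move: ie.
  rewrite (joins_incident _ (joins_bip_edge _ _)) eq_lrshift orbF eq_lshift => /eqP fia.
  have : rshift n1 b \in minor_vertices.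
    by apply: (matching_mem pmE eE); rewrite (joins_incident _ (joins_bip_edge _ _)) eqxx orbT.
  rewrite inE => /orP[]/imsetP[j _]; first by move/eqP; rewrite eq_rlshift.
  by move=> /rshift_inj bj; exists j; rewrite fia -bj.
pose h i := xchoose (ex i); have hE i : bip_edge (f i) (g (h i)) \in E := xchooseP (ex i).
have hinj : injective h.
  move=> i j hij; have : bip_edge (f i) (g (h i)) = bip_edge (f j) (g (h j)).
    apply: (matching_uniq pmE (hE i) (hE j) (u := rshift n1 (g (h i)))).
      by rewrite (joins_incident _ (joins_bip_edge _ _)) eqxx orbT.
    by rewrite (joins_incident _ (joins_bip_edge _ _)) hij eqxx orbT.
  by move=> /bip_edge_inj[/finj].
exists (perm hinj); apply/setP => e; apply/idP/imsetP => [eE|[i _ ->]]; last first.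
  by rewrite /perm_edge permE.
have [a [b eab]] := bipartiteP (bipE e eE); subst e.
have : lshift n2 a \in minor_vertices.
  by apply: (matching_mem pmE eE); rewrite (joins_incident _ (joins_bip_edge _ _)) eqxx.
rewrite inE => /orP[]/imsetP[i _]; last by move/eqP; rewrite eq_lrshift.
move=> /lshift_inj ai; exists i => //; rewrite /perm_edge permE.
apply: (matching_uniq pmE eE (hE i) (u := lshift n2 a)).
  by rewrite (joins_incident _ (joins_bip_edge _ _)) eqxx.
by rewrite (joins_incident _ (joins_bip_edge _ _)) ai eqxx.
Qed.

End Minor.

Lemma crossing_perm_matching r (f : {ffun 'I_r -> 'I_n1}) (g : {ffun 'I_r -> 'I_n2})
    (s : 'S_r) : increasing f -> increasing g ->
  crossing_number (perm_matching f g s) = noninversions s.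
Proof.
move=> finc ginc; have finj := increasing_inj finc; have ginj := increasing_inj ginc.
have f_lt i j : (f i < f j)%N = (i < j)%N.
  case: (ltngtP i j) => [/(increasing_lt finc)//|/(increasing_lt finc)/ltnW|/val_inj ->].
    by rewrite leqNgt => /negbTE.
  by rewrite ltnn.
have g_lt i j : (g i < g j)%N = (i < j)%N.
  case: (ltngtP i j) => [/(increasing_lt ginc)//|/(increasing_lt ginc)/ltnW|/val_inj ->].
    by rewrite leqNgt => /negbTE.
  by rewrite ltnn.
pose c := perm_edge f g s; have cinj : injective c by apply: perm_edge_inj.
have crossE i j : cross (c i) (c j) =
    ((i < j) && (s i < s j) || (j < i) && (s j < s i))%N.
  rewrite /cross /= !ltn_add2l !g_lt !f_lt.
  have f_ltn i' j' : (f i' < n1 + g j')%N by rewrite ltn_addr.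
  by rewrite !f_ltn !andbT.
rewrite /crossing_number /noninversions.
pose D := [set ij : 'I_r * 'I_r | (ij.1 < ij.2)%N && (s ij.1 < s ij.2)%N].
pose p (ij : 'I_r * 'I_r) := [set c ij.1; c ij.2].
(* Crossing pairs are unordered; each is recorded once, with its rows in increasing order. *)
have -> : [set [set e; e'] | e in perm_matching f g s, e' in perm_matching f g s & cross e e']
    = p @: D.
  apply/setP => X; apply/imset2P/imsetP => [[e e']|[[i j]]].
    move=> /imsetP[i _ ->]; rewrite inE => /andP[/imsetP[j _ ->]]; rewrite crossE.
    by case/orP=> ij ->; [exists (i, j) | exists (j, i)]; rewrite ?inE // /p /= finset.setUC.
  rewrite inE /= => ij ->; exists (c i) (c j); rewrite ?imset_f // inE imset_f //=.
  by rewrite crossE ij.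
rewrite card_in_imset // => -[i j] [i' j']; rewrite !inE /= => /andP[ij _] /andP[i'j' _].
move=> /setP pE.
have mem x : (x == i) || (x == j) = (x == i') || (x == j').
  by have := pE (c x); rewrite !inE !(inj_eq cinj).
have := mem i; have := mem j; have := mem i'; rewrite !eqxx /= ?orbT.
move=> /orP[]/eqP e1 /esym/orP[]/eqP e2 /esym/orP[]/eqP e3; subst => //.
all: by exfalso; lia.
Qed.

End Bipartite.

(** * Pfaffians modulo the inner variables *)

Section PfaffianTrop.
Variables (R : realType) (n1 n2 : nat).
Local Notation n := (n1 + n2)%N.

Definition inner_weight (e : edge n) : R := if bipartite e then 0 else -1.

Definition bip_pair (ij : 'I_n1 * 'I_n2) : edge n := bip_edge ij.1 ij.2.

Lemma sum_perm_matchings (V : nmodType) r (f : {ffun 'I_r -> 'I_n1})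
    (g : {ffun 'I_r -> 'I_n2}) (F : {set edge n} -> V) :
  increasing f -> increasing g ->
  \sum_(E | perfect_matching (minor_vertices f g) E && [forall e in E, bipartite e]) F E
  = \sum_(s : 'S_r) F (perm_matching f g s).
Proof.
move=> /increasing_inj finj /increasing_inj ginj.
rewrite -(big_imset (h := perm_matching f g) (A := predT)) /=; last first.
  by move=> s t _ _; apply: perm_matching_inj.
apply: eq_bigl => E; apply/andP/imsetP => [[pmE /forallP bipE]|[s _ ->]].
  have [|s ->] := perm_matching_surj finj pmE; last by exists s.
  by move=> e; apply/implyP.
split; first exact: perm_matching_perfect.
by apply/forallP => e; apply/implyP; apply: perm_matching_bipartite.
Qed.

Variable K : fieldType.

(** Bipartite matchings correspond to permutations and sum up to the signed minor. Any other
    matching contains an inner edge, whose variable makes the weight negative. *)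
Lemma pfaffian_minor r (f : {ffun 'I_r -> 'I_n1}) (g : {ffun 'I_r -> 'I_n2}) :
  increasing f -> increasing g ->
  wlt inner_weight 0 (pfaffian K (minor_vertices f g) -
    (-1) ^+ noninversions (1%g : 'S_r) *
    msubst bip_pair (\det (mxsub f g (generic_mx n1 n2 K)))).
Proof.
move=> finc ginc; rewrite /pfaffian (bigID (fun E : {set edge n} => [forall e in E, bipartite e])) /=.
rewrite sum_perm_matchings // -det_map_mx /determinant mulr_sumr addrAC -sumrB.
rewrite big1 ?add0r => [|s _]; last first.
  rewrite crossing_perm_matching // sign_noninversions -mulrA -mulrBr.
  rewrite big_imset /=; last by move=> i j _ _; apply: perm_edge_inj; apply: increasing_inj.
  rewrite -mulrBr (eq_bigr (fun i => map_mx (msubst bip_pair) (mxsub f g (generic_mx n1 n2 K)) i (s i))).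
    by rewrite subrr !mulr0.
  by move=> i _; rewrite !mxE msubst_var.
apply: wlt_sum => E /andP[_ /forallPn[e]]; rewrite negb_imply => /andP[eE nbip].
rewrite -[0]addr0; apply: wlt_mul; first exact: wle_sign.
rewrite (bigD1 e eE) /= mulrC -[0]addr0; apply: wlt_mul.
  have -> : 0 = \sum_(i in E | i != e) 0 :> R by rewrite big1.
  apply: wle_prod => i _; apply: (@wle_le _ _ _ _ (inner_weight i)); last exact: wle_var.
  by rewrite /inner_weight; case: ifP; rewrite ?lerN10.
by apply: wltX; rewrite mweight1 /inner_weight (negbTE nbip) ltrN10.
Qed.

Lemma notin_trop_pfaffian (M : 'M[R]_(n1, n2)) k (v0 : edge n -> R) :
  (forall a b, v0 (bip_edge a b) = M a b) -> (k < kapranov_rank K M)%N ->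
  exists c0, forall c, c0 <= c ->
    ~ trop R (pfaffian_ideal n K k) (fun e => v0 e + c * inner_weight e).
Proof.
move=> v0M /kapranov_gtP kM.
pose eps : K := (-1) ^+ noninversions (1%g : 'S_(k.+1)).
apply: (@notin_trop_degenerate R K _ _ bip_pair (@minor_gens K n1 n2 k.+1)
  _ _ v0 inner_weight eps 0%MM _ _ _ _ kM).
- by rewrite signr_eq0.
- by case=> a b; apply: v0M.
- by move=> ij; rewrite /inner_weight bipartite_edge.
move=> _ [f [g [finc ginc ->]]]; exists (pfaffian K (minor_vertices f g)).
  exists (minor_vertices f g) => //=.
  by rewrite card_minor_vertices ?mul2n; [lia | apply: increasing_inj..].
rewrite mweight0 -mul_mpolyC mpolyX0 mulr1 /eps rmorphXn rmorphN rmorph1.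
exact: pfaffian_minor.
Qed.

End PfaffianTrop.

Section Improve.
Variables (R : realType) (n1 n2 k : nat) (M : 'M[R]_(n1, n2)).
Local Notation n := (n1 + n2)%N.
Hypothesis singM : singular_minors M k.+1.

(** Each edge has one end in either part, so both parts of [U] have as many vertices as [E] has
    edges, namely [k + 1]. *)
Lemma bipartite_vertices (U : {set 'I_n}) (E : {set edge n}) :
  #|U| = k.+1.*2 -> perfect_matching U E -> (forall e, e \in E -> bipartite e) ->
  exists (f : {ffun 'I_k.+1 -> 'I_n1}) (g : {ffun 'I_k.+1 -> 'I_n2}),
    [/\ increasing f, increasing g & U = minor_vertices f g].
Proof.
move=> cU pmE bipE.
pose UA := [set a | lshift n2 a \in U]; pose UB := [set b | rshift n1 b \in U].
have incA a b : incident (lshift n2 a) (bip_edge a b).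
  by rewrite (joins_incident _ (joins_bip_edge _ _)) eqxx.
have incB a b : incident (rshift n1 b) (bip_edge a b).
  by rewrite (joins_incident _ (joins_bip_edge _ _)) eqxx orbT.
have UAE : [set (val e).1 | e in E] = [set lshift n2 a | a in UA].
  apply/setP => u; apply/imsetP/imsetP => [[e eE ->]|[a aU ->]].
    have [a [b eab]] := bipartiteP (bipE e eE); exists a; last by rewrite eab.
    by rewrite inE; apply: matching_mem pmE eE _; rewrite eab.
  rewrite inE in aU; have [e eE ae] := matching_incident pmE aU; exists e => //.
  have [a' [b' eab]] := bipartiteP (bipE e eE); move: ae; rewrite eab /=.
  by rewrite (joins_incident _ (joins_bip_edge _ _)) eq_lrshift orbF => /eqP.
have UBE : [set (val e).2 | e in E] = [set rshift n1 b | b in UB].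
  apply/setP => u; apply/imsetP/imsetP => [[e eE ->]|[b bU ->]].
    have [a [b eab]] := bipartiteP (bipE e eE); exists b; last by rewrite eab.
    by rewrite inE; apply: matching_mem pmE eE _; rewrite eab.
  rewrite inE in bU; have [e eE be] := matching_incident pmE bU; exists e => //.
  have [a' [b' eab]] := bipartiteP (bipE e eE); move: be; rewrite eab /=.
  by rewrite (joins_incident _ (joins_bip_edge _ _)) eq_rlshift => /eqP.
have cA : #|UA| = #|E|.
  rewrite -(card_imset UA (@lshift_inj n1 n2)) -UAE card_in_imset // => e e' eE e'E ee'.
  by apply: (matching_uniq pmE eE e'E (u := (val e).1)); rewrite /incident -?ee' eqxx.
have cB : #|UB| = #|E|.
  rewrite -(card_imset UB (@rshift_inj n1 n2)) -UBE card_in_imset // => e e' eE e'E ee'.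
  by apply: (matching_uniq pmE eE e'E (u := (val e).2)); rewrite /incident -?ee' eqxx orbT.
have UE : U = [set lshift n2 a | a in UA] :|: [set rshift n1 b | b in UB].
  apply/setP => u; rewrite inE; case: (split_ordP u) => a ->.
    rewrite [X in _ || X](_ : _ = false) ?orbF ?mem_imset ?inE //; first exact: lshift_inj.
    by apply/negP => /imsetP[b _] /eqP; rewrite eq_lrshift.
  rewrite [X in X || _](_ : _ = false) ?mem_imset ?inE //; first exact: rshift_inj.
  by apply/negP => /imsetP[b _] /eqP; rewrite eq_rlshift.
have cAk : #|UA| = k.+1.
  have := cU; rewrite {1}UE cardsU !card_imset ?cA ?cB; [|exact: rshift_inj|exact: lshift_inj].
  rewrite (_ : _ :&: _ = finset.set0) ?cards0; first lia.
  apply/setP => u; rewrite !inE; apply/negP => /andP[/imsetP[a _ ->] /imsetP[b _]].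
  by move/eqP; rewrite eq_lrshift.
have [f finc fA] := increasing_enum cAk.
have [|g ginc gB] := @increasing_enum k.+1 _ UB; first by rewrite cB -cA.
exists f, g; split=> //; rewrite UE /minor_vertices; congr (_ :|: _); apply/setP => u.
  by apply/imsetP/imsetP => [[a /fA[i ->] ->]|[i _ ->]]; [exists i | exists (f i) => //; apply/fA; exists i].
by apply/imsetP/imsetP => [[a /gB[i ->] ->]|[i _ ->]]; [exists i | exists (g i) => //; apply/gB; exists i].
Qed.

Lemma bipartite_improve (v : edge n -> R) (U : {set 'I_n}) (E : {set edge n}) :
  (forall a b, v (bip_edge a b) = M a b) ->
  #|U| = k.+1.*2 -> perfect_matching U E -> (forall e, e \in E -> bipartite e) ->
  exists E', [/\ perfect_matching U E', forall e, e \in E' -> bipartite e, E' != E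
    & \sum_(e in E) v e <= \sum_(e in E') v e].
Proof.
move=> vM cU pmE bipE; have [f [g [finc ginc UE]]] := bipartite_vertices cU pmE bipE.
have finj := increasing_inj finc; have ginj := increasing_inj ginc.
rewrite {U cU}UE in pmE *; have [s Es] := perm_matching_surj finj pmE bipE.
have /tropically_singularP/(_ s)[t ts le_st] := singM finc ginc.
exists (perm_matching f g t); split; first exact: perm_matching_perfect.
- exact: perm_matching_bipartite.
- by apply: contraNneq ts; rewrite Es => /(perm_matching_inj finj ginj) ->.
have sumE (u : 'S_k.+1) : \sum_(e in perm_matching f g u) v e =
    \sum_i mxsub f g M i (u i).
  rewrite big_imset /=; last by move=> i j _ _; apply: perm_edge_inj.
  by apply: eq_bigr => i _; rewrite vM mxE.
by rewrite Es !sumE.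
Qed.

End Improve.

(** * The prevariety *)

Section Prevariety.
Variables (R : realType) (m1 m2 k : nat) (M : 'M[R]_(m1.+1, m2.+1)).
Local Notation n := (m1.+1 + m2.+1)%N.
Implicit Types (u w h i j p q l : 'I_n) (U : {set 'I_n}) (E : {set edge n}).

Definition side u := (u < m1.+1)%N.

Definition hub u : 'I_n := if side u then rshift m1.+1 ord0 else lshift m2.+1 ord0.

Definition hub_height u : R :=
  match split u with inl a => M a ord0 | inr b => M ord0 b end.

(** Vertices of one part share their hub, and the edge between them weighs as much as the heavier of
    their two edges to it. The penalty is subtracted only in [inner_penalized]. *)
Definition vertex_weight u w : R :=
  match split u, split w with
  | inl a, inr b | inr b, inl a => M a b
  | _, _ => Num.max (hub_height u) (hub_height w)
  end.

Lemma split_lshift a : split (lshift m2.+1 a : 'I_n) = inl a.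
Proof. exact: (unsplitK (inl a)). Qed.

Lemma split_rshift b : split (rshift m1.+1 b : 'I_n) = inr b.
Proof. exact: (unsplitK (inr b)). Qed.

Lemma side_lshift a : side (lshift m2.+1 a).
Proof. by rewrite /side /= ltn_ord. Qed.

Lemma side_rshift b : side (rshift m1.+1 b) = false.
Proof. by rewrite /side /= ltnNge leq_addr. Qed.

Definition splitE := (split_lshift, split_rshift, side_lshift, side_rshift).

Lemma vertex_weightC u w : vertex_weight u w = vertex_weight w u.
Proof.
by rewrite /vertex_weight; case: (split u) => a; case: (split w) => b //; rewrite maxC.
Qed.

Lemma vertex_weight_same u w : side u = side w ->
  vertex_weight u w = Num.max (hub_height u) (hub_height w).
Proof.
rewrite /vertex_weight; case: (split_ordP u) => a uE; case: (split_ordP w) => b wE //;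
  by rewrite uE wE !splitE.
Qed.

Lemma side_hub u : side (hub u) = ~~ side u.
Proof. by rewrite /hub; case: ifP => _; rewrite splitE. Qed.

Lemma vertex_weight_hub u : vertex_weight u (hub u) = hub_height u.
Proof.
rewrite /vertex_weight /hub /hub_height.
by case: (split_ordP u) => a ->; rewrite !splitE.
Qed.

Definition entry_bound : R := \sum_i \sum_j `|M i j|.

Lemma entry_le a b : `|M a b| <= entry_bound.
Proof.
rewrite /entry_bound (bigD1 a) // (bigD1 b) //= -addrA lerDl addr_ge0 ?sumr_ge0 //.
by move=> i _; rewrite sumr_ge0.
Qed.

Lemma hub_height_le u : `|hub_height u| <= entry_bound.
Proof. by rewrite /hub_height; case: (split u) => a; apply: entry_le. Qed.

Lemma vertex_weight_le u w : `|vertex_weight u w| <= entry_bound.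
Proof.
rewrite /vertex_weight; case: (split u) => a; case: (split w) => b; rewrite ?entry_le //.
  by rewrite /Num.max; case: ifP => _; apply: hub_height_le.
by rewrite /Num.max; case: ifP => _; apply: hub_height_le.
Qed.

Lemma bipartite_joins (e : edge n) u w : joins e u w -> bipartite e = (side u != side w).
Proof.
have := valP e; rewrite /bipartite /side /joins => e_lt /orP[]/eqP eE; rewrite eE /= in e_lt *; lia.
Qed.

Variable c : R.
Hypothesis c_large : entry_bound + entry_bound <= c.

Definition inner_penalized u w := vertex_weight u w - (if side u == side w then c else 0).

Lemma inner_penalizedC u w : inner_penalized u w = inner_penalized w u.
Proof. by rewrite /inner_penalized vertex_weightC eq_sym. Qed.

Lemma inner_penalized_hub u w : side u != side w -> w = hub u ->
  inner_penalized u w = hub_height u.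
Proof.
by move=> uw e; rewrite /inner_penalized (negbTE uw) subr0 e vertex_weight_hub.
Qed.

Lemma inner_penalized_same u w : side u = side w ->
  inner_penalized u w = Num.max (hub_height u) (hub_height w) - c.
Proof. by move=> uw; rewrite /inner_penalized uw eqxx vertex_weight_same. Qed.

Local Notation wt := (edge_weight inner_penalized).

(** Inner edges of different parts are exchanged for two bipartite edges: saving the penalty twice
    outweighs four entries. Within one part the penalties stay, and one of the two other pairings
    does not lose. *)
Lemma two_inner_improve U E e f : perfect_matching U E -> e \in E -> f \in E ->
  e != f -> ~~ bipartite e -> ~~ bipartite f ->
  exists2 E', perfect_matching U E' && (E' != E)
    & \sum_(x in E) wt x <= \sum_(x in E') wt x.
Proof.
move=> pmE eE fE ef.
move: (val e).1 (val e).2 (val f).1 (val f).2 (joins_val e) (joins_val f) => i j p q eij fpq.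
rewrite (bipartite_joins eij) (bipartite_joins fpq) !negbK => /eqP ij /eqP pq.
have fqp : joins f q p by rewrite joins_sym.
have [E1 [pm1 ne1 sum1]] := matching_swap inner_penalizedC pmE eE fE ef eij fpq.
have [E2 [pm2 ne2 sum2]] := matching_swap inner_penalizedC pmE eE fE ef eij fqp.
have Wij := inner_penalized_same ij; have Wpq := inner_penalized_same pq.
have [ip|ip] := eqVneq (side i) (side p); last first.
  have Wip : inner_penalized i p = vertex_weight i p.
    by rewrite /inner_penalized (negbTE ip) subr0.
  have Wjq : inner_penalized j q = vertex_weight j q.
    by rewrite /inner_penalized -ij -pq (negbTE ip) subr0.
  exists E1; rewrite ?pm1 // sum1 Wij Wpq Wip Wjq.
  have := vertex_weight_le i p; have := vertex_weight_le j q.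
  rewrite -(vertex_weight_same ij) -(vertex_weight_same pq).
  have := vertex_weight_le i j; have := vertex_weight_le p q.
  rewrite !ler_norml => /andP[_ ?] /andP[_ ?] /andP[? _] /andP[? _].
  have c0 : 0 <= c - entry_bound - entry_bound by rewrite !subr_ge0 lerBrDr.
  lra.
have iq : side i = side q by rewrite ip.
have jp : side j = side p by rewrite -ij.
have jq : side j = side q by rewrite -ij.
have Wqp : inner_penalized q p = inner_penalized p q := inner_penalizedC q p.
(* The good pairing keeps the larger of [a] and [b] apart from the larger of [x] and [y], so that
   both still count. *)
have max_exchange (a b x y : R) :
  Num.max a b + Num.max x y <= Num.max a x + Num.max b y \/
  Num.max a b + Num.max x y <= Num.max a y + Num.max b x.
  case: (leP a b) => _; case: (leP x y) => _; [right; rewrite addrC|left; rewrite addrC|left|right];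
    by apply: lerD; rewrite le_max lexx ?orbT.
have [le1|le2] := max_exchange (hub_height i) (hub_height j) (hub_height p) (hub_height q).
  exists E1; rewrite ?pm1 // sum1 Wij Wpq (inner_penalized_same ip) (inner_penalized_same jq); lra.
exists E2; rewrite ?pm2 // sum2 Wqp Wij Wpq (inner_penalized_same iq) (inner_penalized_same jp); lra.
Qed.

Hypothesis singM : singular_minors M k.+1.

Lemma wt_bip_edge a b : wt (bip_edge a b) = M a b.
Proof.
by rewrite /edge_weight /inner_penalized /vertex_weight /= !splitE /= subr0.
Qed.

(* The inner edge [{i, j}] counts as an edge [{j, h}] to the hub [h].  If [h] is
   not in [U], replace [{i, j}] by [{j, h}], improve the resulting bipartite
   matching, and move the edge at [h] back to [i]. *)
Lemma one_inner_improve U E e i j : #|U| = k.+1.*2 -> perfect_matching U E -> e \in E ->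
  (forall f, f \in E -> f != e -> bipartite f) ->
  joins e i j -> side i = side j -> hub_height i <= hub_height j ->
  exists2 E', perfect_matching U E' && (E' != E)
    & \sum_(x in E) wt x <= \sum_(x in E') wt x.
Proof.
move=> cU pmE eE bipE eij ij Hij; pose h := hub j.
have jh : side j != side h by rewrite side_hub; case: (side j).
have hubE l : side l != side h -> h = hub l.
  by rewrite side_hub /h /hub; case: (side j); case: (side l).
have ih : i != h by apply: contraNneq jh => <-; rewrite ij.
have Wij : inner_penalized i j = hub_height j - c.
  by rewrite inner_penalized_same //; case: leP Hij => // ? ?; lra.
have Wjh : inner_penalized j h = hub_height j by apply: inner_penalized_hub.
have iU : i \in U by apply: matching_mem pmE eE _; rewrite (joins_incident _ eij) eqxx.
(* If the hub is matched, its partner [l] lies in the part of [i]: the swap gives [j] the hub and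
   leaves {i, l} as the inner edge. *)
have [hU|hU] := boolP (h \in U).
  have [f fE hf] := matching_incident pmE hU; have [l fhl] := incident_joins hf.
  have fe : f != e.
    apply: contraTneq hf => ->; rewrite (joins_incident _ eij) eq_sym (negbTE ih) /=.
    by apply: contraNneq jh => ->.
  have := bipE f fE fe; rewrite (bipartite_joins fhl) eq_sym => lh.
  rewrite joins_sym in fhl; rewrite eq_sym in fe.
  have [E' [pm' ne' sum']] := matching_swap inner_penalizedC pmE eE fE fe eij fhl.
  exists E'; rewrite ?pm' // sum' Wij Wjh (inner_penalized_hub lh (hubE l lh)).
  have il : side i = side l by rewrite ij; case: (side j) (side l) (side h) jh lh => [] [] [].
  rewrite inner_penalized_same //.
  have : hub_height l <= Num.max (hub_height i) (hub_height l) by rewrite le_max lexx orbT.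
  lra.
have jNh : j != h by apply: contraNneq jh => <-.
have [e1 e1jh] := joins_ex jNh.
have [pm1 e1E sum1] := matching_retarget inner_penalizedC pmE eE eij e1jh hU.
have e1D : e1 \notin E :\ e by rewrite !inE (negbTE e1E) andbF.
have cU1 : #|h |: (U :\ i)| = k.+1.*2.
  by rewrite cardsU1 !inE (negbTE hU) andbF -cU [in RHS](cardsD1 i) iU.
have bip1 f : f \in e1 |: (E :\ e) -> bipartite f.
  rewrite !inE => /orP[/eqP ->|/andP[fe fE]]; last exact: bipE.
  by rewrite (bipartite_joins e1jh).
have [E2 [pm2 bip2 ne2 le2]] := bipartite_improve singM wt_bip_edge cU1 pm1 bip1.
have hU1 : h \in h |: (U :\ i) by rewrite !inE eqxx.
have [e2 e2E he2] := matching_incident pm2 hU1; have [l e2hl] := incident_joins he2.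
have := bip2 e2 e2E; rewrite (bipartite_joins e2hl) eq_sym => lh.
have il : side i = side l by rewrite ij; case: (side j) (side l) (side h) jh lh => [] [] [].
have iU1 : i \notin h |: (U :\ i) by rewrite !inE (negbTE ih) eqxx.
have li : l != i.
  apply: contraNneq iU1 => li; rewrite -{1}li; apply: matching_mem pm2 e2E _.
  by rewrite (joins_incident _ e2hl) eqxx orbT.
have [e3 e3li] := joins_ex li.
have [pm3 e3E2 sum3] := matching_retarget inner_penalizedC pm2 e2E e2hl e3li iU1.
have UE : i |: ((h |: (U :\ i)) :\ h) = U.
  apply/setP => x; rewrite !inE; have [->|xi] := eqVneq x i; first by rewrite iU.
  by have [->|xh] := eqVneq x h; rewrite /= ?(negbTE hU).
rewrite UE in pm3; exists (e3 |: (E2 :\ e2)).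
  (* If the final matching were [E], then [e3 = e], hence [l = j] and [e2 = e1], and the improvement
     of the bipartite matching would have changed nothing. *)
  rewrite pm3 /=; apply: contraNneq ne2 => E3E.
  have e3E : e3 \in E by rewrite -E3E !inE eqxx.
  have e3e : e3 = e.
    apply: (matching_uniq pmE e3E eE (u := i)).
      by rewrite (joins_incident _ e3li) eqxx orbT.
    by rewrite (joins_incident _ eij) eqxx.
  have lj : l = j.
    have := joins_incident l e3li; rewrite e3e (joins_incident _ eij) eqxx (negbTE li) /=.
    by move/eqP.
  have e2jh : joins e2 j h by rewrite joins_sym -lj.
  have e12 : e2 = e1 := joins_inj e2jh e1jh.
  have D3 : E2 :\ e2 = E :\ e.
    by rewrite -E3E -e3e finset.setU1K // finset.in_setD1 (negbTE e3E2) andbF.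
  by rewrite -(@finset.setD1K _ e2 E2 e2E) D3 e12.
have le_hl : hub_height l <= Num.max (hub_height l) (hub_height i) by rewrite le_max lexx.
have Wli : inner_penalized l i = Num.max (hub_height l) (hub_height i) - c.
  by rewrite inner_penalized_same.
have Whl : inner_penalized h l = hub_height l.
  by rewrite inner_penalizedC; apply: inner_penalized_hub => //; apply: hubE.
move: le2; rewrite sum3 sum1 Wij Wjh Whl Wli; lra.
Qed.

Lemma matching_improve U E : #|U| = k.+1.*2 -> perfect_matching U E ->
  exists2 E', perfect_matching U E' && (E' != E)
    & \sum_(x in E) wt x <= \sum_(x in E') wt x.
Proof.
move=> cU pmE.
have [/existsP[e /andP[eE nbe]]|none] := boolP [exists e in E, ~~ bipartite e]; last first.
  have [|E' [pm' _ ne' le']] := bipartite_improve singM wt_bip_edge cU pmE.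
    move=> e eE; apply: contraNT none => nbe; apply/existsP; exists e.
    by rewrite eE.
  by exists E'; rewrite ?pm'.
have [/existsP[f /and3P[fE fe nbf]]|one] :=
  boolP [exists f, [&& f \in E, f != e & ~~ bipartite f]].
  by apply: (two_inner_improve pmE eE fE) => //; rewrite eq_sym.
have bipE f : f \in E -> f != e -> bipartite f.
  move=> fE fe; apply: contraNT one => nbf; apply/existsP; exists f.
  by rewrite fE fe.
have eij := joins_val e; have ij := nbe; rewrite (bipartite_joins eij) negbK in ij.
move: ij => /eqP ij.
have [le_ij|/ltW le_ji] := leP (hub_height (val e).1) (hub_height (val e).2).
  exact: one_inner_improve cU pmE eE bipE eij ij le_ij.
by apply: one_inner_improve cU pmE eE bipE _ (esym ij) le_ji; rewrite joins_sym.
Qed.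

Lemma prevariety_mem (v : edge n -> R) : (forall e, v e = wt e) ->
  pfaffian_prevariety n R k v.
Proof.
move=> vE U cardU; have cU : #|U| = k.+1.*2 by rewrite cardU; lia.
apply/max_attained_twiceP; split; first exact: perfect_matching_ex cU.
move=> E pmE; have [E' pm' le'] := matching_improve cU pmE; exists E' => //.
by rewrite (eq_bigr wt) // [leRHS](eq_bigr wt).
Qed.

End Prevariety.

(** * Gaps between tropical and Kapranov rank *)

(** Without rows or columns there are no minors of positive size, and the zero ideal has no monomial
    initial form. This provides the first row and column that serve as hubs. *)
Lemma kapranov_gt0 (R : realType) (K : fieldType) n1 n2 (M : 'M[R]_(n1, n2)) k :
  (k < kapranov_rank K M)%N -> (0 < n1)%N && (0 < n2)%N.
Proof.
move=> /kapranov_gtP/notin_tropP[f [m [[s [sS ->]] fm]]].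
case: s sS fm => [|x s] sS fm.
  have := fm m; rewrite big_nil sub0r mcoeffN mcoeffX eqxx oppr_eq0 oner_eq0 ltxx.
  by move=> /(_ isT).
have [f' [g' [/increasing_leq le1 /increasing_leq le2 _]]] := sS x (mem_head _ _).
by rewrite (leq_trans _ le1) ?(leq_trans _ le2).
Qed.

Lemma prevariety_neq_trop (R : realType) (K : fieldType) k n1 n2 (M : 'M[R]_(n1, n2)) :
  (tropical_rank M <= k)%N -> (k < kapranov_rank K M)%N ->
  pfaffian_prevariety (n1 + n2) R k <> trop R (pfaffian_ideal (n1 + n2) K k).
Proof.
move=> /tropical_rank_leP singM kM; have /andP[] := kapranov_gt0 kM.
case: n1 n2 M singM kM => [|n1] [|n2] // M singM kM _ _.
pose v0 := edge_weight (vertex_weight M).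
have v0M a b : v0 (bip_edge a b) = M a b.
  by rewrite /v0 /edge_weight /vertex_weight /= !splitE.
have [c0 Hc] := notin_trop_pfaffian v0M kM.
(* One penalty serves both purposes: leaving the tropical variety and exchanging inner edges. *)
pose c := Num.max c0 (entry_bound M + entry_bound M).
have c_large : entry_bound M + entry_bound M <= c by rewrite le_max lexx orbT.
move=> eq_trop; apply: (Hc c); first by rewrite le_max lexx.
rewrite -eq_trop; apply: (prevariety_mem c_large singM) => e.
rewrite /v0 /edge_weight /inner_penalized /inner_weight (bipartite_joins (joins_val e)).
by case: eqP => _ /=; rewrite ?mulrN1 ?mulr0 ?subr0 ?addr0.
Qed.

Section Examples.
Variables (R : realType) (K : fieldType).

Definition rank_gap k n1 n2 := exists M : 'M[R]_(n1, n2),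
  (tropical_rank M <= k)%N /\ (k < kapranov_rank K M)%N.

(** Minors of the enlarged matrix are selections from [M], possibly with a repeated row, and [M]
    remains a submatrix. *)
Lemma rank_gap_row k n1 n2 : rank_gap k n1 n2 -> rank_gap k n1.+1 n2.
Proof.
move=> [M [trM kM]]; have /andP[n1_gt0 _] := kapranov_gt0 kM.
case: n1 n1_gt0 M trM kM => // n1 _ M trM kM.
exists (mxsub (@unlift0 n1) id M); split.
  apply/tropical_rank_leP => f g _ _; rewrite -[mxsub f g _]/(mxsub f g (mxsub _ _ _)).
  rewrite (_ : mxsub f g _ = mxsub (@unlift0 n1 \o f) g M); last by apply/matrixP => i j; rewrite !mxE.
  exact/singular_mxsub/tropical_rank_leP.
apply: (kapranov_embed (e1 := lift ord0) (e2 := id)) kM => // i j.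
by rewrite mxE unlift0_lift.
Qed.

Lemma rank_gap_corner k n1 n2 : rank_gap k n1.+1 n2.+1 -> rank_gap k.+1 n1.+2 n2.+2.
Proof.
move=> [M [/tropical_rank_corner[c1 H1] /kapranov_corner[c2 H2]]].
exists (corner M (Num.max c1 c2)); split; [apply: H1 | apply: H2].
  by rewrite le_max lexx.
by rewrite le_max lexx orbT.
Qed.

Lemma rank_gap_shitov d e : rank_gap (4 + d) (6 + d + e) (6 + d).
Proof.
elim: e => [|e IHe]; last by rewrite addnS; apply: rank_gap_row.
rewrite addn0; elim: d => [|d IHd].
  by exists (cost_mx shitov_cost R 6); split;
    [apply: shitov_tropical_rank | apply: shitov_kapranov_rank].
by rewrite !addnS; apply: rank_gap_corner.
Qed.

Lemma rank_gap_fano e : (2%:R : K) != 0 -> rank_gap 3 (7 + e) 7.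
Proof.
move=> two_neq0; elim: e => [|e IHe]; last by rewrite addnS; apply: rank_gap_row.
by exists (cost_mx fano_cost R 7); split;
  [apply: fano_tropical_rank | apply: fano_kapranov_rank].
Qed.

End Examples.

Theorem theorem3p7 (R : realType) :
  (forall (K : fieldType) (k n1 n2 : nat) (M : 'M[R]_(n1, n2)),
     (1 <= k)%N -> (tropical_rank M <= k)%N -> (k < kapranov_rank K M)%N ->
     pfaffian_prevariety (n1 + n2) R k
       <> trop R (pfaffian_ideal (n1 + n2) K k))
  /\
  (forall K : fieldType,
     [\/ K = rat :> fieldType, K = R :> fieldType | K = R[i] :> fieldType] ->
   forall k n : nat,
     (k = 3%N /\ (14 <= n)%N) \/ ((4 <= k)%N /\ (2 * k + 4 <= n)%N) ->
     (exists (n1 n2 : nat) (M : 'M[R]_(n1, n2)),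
        [/\ (n1 + n2 = n)%N, (tropical_rank M <= k)%N
          & (k < kapranov_rank K M)%N])
     /\ pfaffian_prevariety n R k
          <> trop R (pfaffian_ideal n K k)).
Proof.
split=> [K k n1 n2 M _|K HK k n kn]; first exact: prevariety_neq_trop.
(* The three fields have characteristic 0; this serves the Fano certificate. *)
have two_neq0 : (2%:R : K) != 0 by case: HK => ->; rewrite pnatr_eq0.
have [n1 [n2 [nE [M [trM kM]]]]] : exists n1 n2, (n1 + n2 = n)%N /\ rank_gap R K k n1 n2.
  case: kn => -[kE ln].
    exists (7 + (n - 14))%N, 7%N; split; first lia.
    by rewrite kE; apply: rank_gap_fano.
  (* A square matrix of size [6 + (k - 4)] accounts for [2 * k + 4] vertices; the others come from
     repeated rows. *)
  exists (6 + (k - 4) + (n - (2 * k + 4)))%N, (6 + (k - 4))%N; split; first lia.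
  rewrite -{1}(subnKC kE); exact: rank_gap_shitov.
split; first by exists n1, n2, M.
by rewrite -nE; apply: prevariety_neq_trop kM.
Qed.
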